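(* Let $0<\varepsilon<1$ and consider edge-weighted graphs with positive weights normalized so that the maximum edge weight is $1$. There is a deterministic $\mathrm{DistLocal}[r]$-algorithm for computing a $(1-\varepsilon)$-approximate maximum weighted matching (a matching $M$ with $w(M)\ge(1-\varepsilon)w(M^*_w)$, $M^*_w$ a maximum weight matching) with $$r\le O\!\left(\frac{1}{\varepsilon^2}\log\frac{1}{\varepsilon}\cdot\log^* n\right)+\Delta^{O(1/\varepsilon)}\cdot\log\left(\frac{1}{w_{\min}(\varepsilon)}\right).$$
   Context: $w_{\min}(\varepsilon)=\min\{w(e): w(e)\ge\varepsilon/n\}$, so $1/w_{\min}(\varepsilon)\le n/\varepsilon$; $w(F)=\sum_{e\in F}w(e)$. In the DistLocal model, computation takes place on an undirected graph with $n$ vertices and maximum degree $\Delta$; each vertex is a processor whose local input includes its distinct ID (polynomially bounded in $n$), its degree, $\Delta$, $n$, $\varepsilon$, the weights of its incident edges, and its ports. In synchronous rounds each vertex receives messages from neighbors, computes arbitrarily, and sends an unbounded-length message to each neighbor; after the last round each vertex outputs which incident edges are in the matching. $\mathrm{DistLocal}[r]$ means $r$ rounds.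
   Formalization: Both logarithms in the bound, log(1/ε) and log(1/w_min(ε)), are read as max(1, log₂ ·); literally, unit weights give log(1/w_min)=0 and a bound independent of Δ, contradicting the known lower bound for approximate matching. *)

(* Defs.v *)
From HB Require Import structures.
From mathcomp Require Import all_boot all_order all_algebra.
From mathcomp Require Import reals exp.

Set Implicit Arguments.
Unset Strict Implicit.
Unset Printing Implicit Defensive.

Import Order.TTheory GRing.Theory Num.Theory.
Local Open Scope ring_scope.

Section Logarithms.
Variable R : realType.

Definition log2 (x : R) : R := ln x / ln 2%:R.

(* log* n is the least i such that the i-th iterate of log2 at n is at most 1.
   Since log* n <= n, searching among 0, ..., n finds it. *)
Definition logstar (n : nat) : nat :=
  find (fun i => iter i log2 n%:R <= 1) (iota 0 n.+1).

(* The logarithm of asymptotic bounds: it equals log2 x for x >= 2 and is kept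
   at least 1 below. A bare logarithm would vanish on unit weights and leave a
   bound independent of the maximum degree, which contradicts the lower bounds
   known for approximate matching. *)
Definition lg (x : R) : R := Num.max 1 (log2 x).

End Logarithms.

Section WeightedGraphs.
Variable R : realType.

Record wgraph := WGraph {
  vert :> finType;
  edges : {set {set vert}};
  edges_card2 : forall e, e \in edges -> #|e| = 2%N;
  wt : {set vert} -> R;
  wt_gt0 : forall e, e \in edges -> 0 < wt e
}.

Variable G : wgraph.

Definition nbrs (v : G) : {set G} := [set u | [set v; u] \in edges G].

Definition max_degree : nat := \max_(v : G) #|nbrs v|.

Definition weight (F : {set {set G}}) : R := \sum_(e in F) wt e.

Definition normalized : Prop := \big[Num.max/0]_(e in edges G) wt e = 1.

Definition matching (M : {set {set G}}) : bool :=
  (M \subset edges G) && trivIset M.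

Definition max_weight_matching (M : {set {set G}}) : Prop :=
  matching M /\ forall M', matching M' -> weight M' <= weight M.

Definition approx_mwm (eps : R) (M : {set {set G}}) : Prop :=
  matching M /\
  forall Mopt, max_weight_matching Mopt -> (1 - eps) * weight Mopt <= weight M.

(* On a normalized graph the default value 1 does not alter the minimum: all
   weights are at most 1, and an edge of weight 1 belongs to the range. *)
Definition wmin (eps : R) : R :=
  \big[Num.min/1]_(e in edges G | eps / #|G|%:R <= wt e) wt e.

End WeightedGraphs.

Section DistLocal.
Variable R : realType.

(* [ports v] lists the neighbours of v in an arbitrary order; port i of v is
   position i of that list. *)
Record network (G : wgraph R) := Network {
  ident : G -> nat;
  ident_inj : injective ident;
  ports : G -> seq G;
  ports_uniq : forall v, uniq (ports v);
  ports_nbrs : forall v, ports v =i nbrs v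
}.

(* [in_wts] lists the weights of the incident edges in the order of the ports,
   which are numbered from 0 to [in_deg] - 1. *)
Record local_input := LocalInput {
  in_id : nat;
  in_deg : nat;
  in_maxdeg : nat;
  in_n : nat;
  in_eps : R;
  in_wts : seq R
}.

(* [alg_send s i] is the message sent through port i in state s, and
   [alg_recv s ms] the state reached from s when ms lists the messages received
   through the ports, in order. [alg_out s] is [None] as long as the vertex has
   not fixed its output; the output is the set of the ports whose edges are in
   the matching. *)
Record algorithm := Algorithm {
  alg_state : Type;
  alg_msg : Type;
  alg_init : local_input -> alg_state;
  alg_send : alg_state -> nat -> alg_msg;
  alg_recv : alg_state -> seq alg_msg -> alg_state;
  alg_out : alg_state -> option (pred nat)
}.

Variables (A : algorithm) (G : wgraph R) (N : network G) (eps : R).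

Definition input_at (v : G) : local_input :=
  {| in_id := ident N v;
     in_deg := #|nbrs v|;
     in_maxdeg := max_degree G;
     in_n := #|G|;
     in_eps := eps;
     in_wts := [seq wt [set v; u] | u <- ports N v] |}.

Fixpoint state_at (t : nat) (v : G) : alg_state A :=
  if t is t'.+1 then
    alg_recv (state_at t' v)
      [seq alg_send (state_at t' u) (index v (ports N u)) | u <- ports N v]
  else alg_init A (input_at v).

(* An output is irrevocable: only the first one produced counts. *)
Fixpoint output_at (t : nat) (v : G) : option (pred nat) :=
  if t is t'.+1 then
    if output_at t' v is Some o then Some o else alg_out (state_at t v)
  else alg_out (state_at 0 v).

(* After r rounds every vertex has produced its output, and the two endpoints
   of every edge agree on whether that edge is in M. *)
Definition computes_in (r : nat) (M : {set {set G}}) : Prop :=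
  forall v : G, exists2 o : pred nat,
    output_at r v = Some o &
    forall u, u \in nbrs v -> o (index u (ports N v)) = ([set v; u] \in M).

End DistLocal.

(* Main.v *)
Require Import Defs.
From mathcomp Require Import all_boot all_order all_algebra finfield.
From mathcomp Require Import zify ring lra.
From mathcomp Require Import boolp reals exp.

(* Edges lighter than eps/n are dropped, which costs at most eps/2. The matching
   is improved by local search: colour the vertices so that equal colours are at
   distance Omega(1/eps) (Linial's colour reduction, log* n steps), then sweep
   over thresholds T0/2^j and colours, letting each vertex of the current colour
   replace the matching inside its ball of radius O(1/eps) when this gains at
   least the threshold. If mu and opt exchange the partners of the current and of
   an optimal matching, walks of length k along the permutation mu \o opt show that
   the best local gains sum to at least w(opt) - (1 + 1/k) w(mu); as thresholds
   decrease, a local gain destroyed during a sweep is paid for by the change that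
   destroyed it, so one sweep realizes a fraction Delta^(-O(1/eps)) of this sum,
   and Delta^O(1/eps) sweeps suffice.

   No vertex knows w_min. But a vertex ignores the thresholds far below the edge
   weights in its ball, so only O(log(1/w_min)) + Delta^O(1/eps) thresholds per
   sweep have any effect, and the result at a vertex is determined by a ball of
   the announced radius. Each vertex collects its view and outputs as soon as all
   networks with that view yield the same result. *)

Set Implicit Arguments.
Unset Strict Implicit.
Unset Printing Implicit Defensive.

Import Order.TTheory GRing.Theory Num.Theory.
Local Open Scope ring_scope.

(** * Balls *)

Section Balls.
Variable I : finType.
Implicit Types (e : rel I) (i j l : I) (s t : nat).

Fixpoint ball e t i : {set I} :=
  if t is t'.+1 then i |: \bigcup_(j | e i j) ball e t' j else [set i].

Lemma ball_refl e t i : i \in ball e t i.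
Proof. by case: t => [|t]; rewrite !inE eqxx. Qed.

Lemma ballSP e t i j :
  reflect (j = i \/ exists2 l, e i l & j \in ball e t l) (j \in ball e t.+1 i).
Proof.
apply: (iffP setU1P) => -[->|]; try by left.
  by move=> /bigcupP[l il jl]; right; exists l.
by move=> [l il jl]; right; apply/bigcupP; exists l.
Qed.

Lemma ball_leq e s t i : (s <= t)%N -> {subset ball e s i <= ball e t i}.
Proof.
elim: s t i => [|s IH] t i.
  by move=> _ j; rewrite inE => /eqP->; exact: ball_refl.
case: t => // t st j; case/ballSP=> [->|[l il jl]]; apply/ballSP; first by left.
by right; exists l => //; apply: IH jl.
Qed.

Lemma ball_trans e s t i j l :
  j \in ball e s i -> l \in ball e t j -> l \in ball e (s + t) i.
Proof.
elim: s i => [|s IH] i; first by rewrite /= inE => /eqP->.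
case/ballSP => [->|[m im jm]] lj; first by apply: ball_leq lj; exact: leq_addl.
by apply/ballSP; right; exists m => //; apply: IH.
Qed.

Lemma ball_rel e i j : e i j -> j \in ball e 1 i.
Proof. by move=> ij; apply/ballSP; right; exists j => //; rewrite inE. Qed.

Lemma ball_sym e t i j : symmetric e -> (j \in ball e t i) = (i \in ball e t j).
Proof.
move=> e_sym; suff sub x y : y \in ball e t x -> x \in ball e t y.
  by apply/idP/idP; apply: sub.
elim: t x => [|t IH] x; first by rewrite !inE eq_sym.
case/ballSP=> [->|[l xl /IH yl]]; first exact: ball_refl.
by rewrite -addn1; apply: ball_trans yl _; apply: ball_rel; rewrite e_sym.
Qed.

Lemma card_ball e b t i : (forall j, #|e j| < b)%N -> (#|ball e t i| <= b ^ t)%N.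
Proof.
move=> e_deg; elim: t i => [|t IH] i; first by rewrite cards1.
have card_cup : (#|\bigcup_(j | e i j) ball e t j| <= #|e i| * b ^ t)%N.
  rewrite -sum_nat_const.
  elim/big_rec2: _ => [|j m A _ leAm]; first by rewrite cards0.
  by rewrite (leq_trans (leq_card_setU _ _)) // leq_add.
rewrite /= (leq_trans (leq_card_setU _ _)) // cards1 expnS.
have bt_gt0 : (0 < b ^ t)%N by rewrite expn_gt0 (leq_ltn_trans _ (e_deg i)).
by have := e_deg i; nia.
Qed.

End Balls.

Section WeightedBalls.
Variables (R : numDomainType) (I : finType).
Implicit Types (W : I -> I -> R) (i j : I) (s t : nat).

Definition link W : rel I := fun i j => 0 < W i j.

Lemma link_sym W : commutative W -> symmetric (link W).
Proof. by move=> symW i j; rewrite /link symW. Qed.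

Definition agree W W' t i : Prop := {in ball (link W) t i, forall j, W j =1 W' j}.

Lemma agree_leq W W' s t i : (s <= t)%N -> agree W W' t i -> agree W W' s i.
Proof. by move=> st WW' j js; apply: WW'; apply: ball_leq js. Qed.

Lemma agree_in_ball W W' s t i j :
  j \in ball (link W) s i -> agree W W' (s + t) i -> agree W W' t j.
Proof. by move=> ji WW' l lj; apply: WW'; apply: ball_trans ji lj. Qed.

Lemma agree_ball W W' t i :
  agree W W' t i -> ball (link W) t i = ball (link W') t i.
Proof.
elim: t i => [//|t IH] i WW' /=; congr (_ |: _).
have WiE : W i =1 W' i by apply: WW'; apply: ball_refl.
apply: eq_big => j; first by rewrite /link WiE.
by move=> ij; apply: IH; apply: agree_in_ball (ball_rel ij) _.
Qed.

End WeightedBalls.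

(** * Local changes *)

Section LocalChanges.
Variables (R : realDomainType) (I : finType).
Implicit Types (W : I -> I -> R) (mu nu opt : I -> I) (B S : {set I}) (u v : I).

(* A matching is encoded by the involution exchanging the ends of its edges; the
   unmatched vertices are fixed points. *)
Definition pairing W mu : bool :=
  [forall v, (mu (mu v) == v) && ((mu v == v) || link W v (mu v))].

(* Twice the weight of the matching. *)
Definition pairing_weight W mu : R := \sum_v W v (mu v).

Lemma pairingP W mu :
  reflect (involutive mu /\ forall v, mu v = v \/ 0 < W v (mu v)) (pairing W mu).
Proof.
apply: (iffP forallP) => [mu_ok|[muK mu_link] v].
  by split=> v; have /andP[/eqP muK /predU1P] := mu_ok v.
by rewrite muK eqxx; apply/predU1P.
Qed.

Lemma pairing_id W : pairing W id.
Proof. by apply/pairingP; split=> // v; left. Qed.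

Lemma pairing_ball W mu v : pairing W mu -> mu v \in ball (link W) 1 v.
Proof.
by case/pairingP=> _ /(_ v)[->|v_mu]; [exact: ball_refl|exact: ball_rel].
Qed.

Definition max_pairing W opt : Prop :=
  pairing W opt /\
  forall mu, pairing W mu -> pairing_weight W mu <= pairing_weight W opt.

Lemma max_pairing_exists W : exists opt, max_pairing W opt.
Proof.
have pairing_finfun mu : pairing W [ffun v => mu v] = pairing W mu.
  by apply: eq_forallb => v; rewrite !ffunE.
have id_pairing : pairing W [ffun v => v] by rewrite pairing_finfun pairing_id.
case: (@arg_maxP _ _ _ _ (fun mu : {ffun I -> I} => pairing W mu)
         (fun mu : {ffun I -> I} => pairing_weight W mu) id_pairing).
move=> opt opt_pairing opt_max.
exists opt; split=> // mu mu_pairing.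
suff -> : pairing_weight W mu = pairing_weight W [ffun v => mu v].
  by apply: opt_max; rewrite pairing_finfun.
by apply: eq_bigr => v _; rewrite ffunE.
Qed.

(* A vertex of B whose partner lies outside keeps its partner, so that a change can
   be validated inside B. *)
Definition change_within W B mu nu : bool :=
  [forall v in B,
     if mu v \in B
     then [&& nu v \in B, nu (nu v) == v & (nu v == v) || link W v (nu v)]
     else nu v == mu v].

Definition gain_within W B mu nu : R := \sum_(v in B) (W v (nu v) - W v (mu v)).

Lemma change_within_inside W B mu nu v :
  change_within W B mu nu -> v \in B -> mu v \in B ->
  [/\ nu v \in B, nu (nu v) = v & nu v = v \/ 0 < W v (nu v)].
Proof.
move=> /forall_inP nu_change vB mu_vB; move: (nu_change v vB); rewrite mu_vB.
by case/and3P=> nu_vB /eqP nuK /predU1P.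
Qed.

Lemma change_within_boundary W B mu nu v :
  change_within W B mu nu -> v \in B -> mu v \notin B -> nu v = mu v.
Proof.
move=> /forall_inP nu_change vB /negPf mu_vB.
by move: (nu_change v vB); rewrite mu_vB => /eqP.
Qed.

Definition worthwhile W B (tau : R) mu nu : bool :=
  change_within W B mu nu && (tau <= gain_within W B mu nu).

Definition improvable W B (tau : R) mu : bool :=
  [exists nu : {ffun I -> I}, worthwhile W B tau mu nu].

Definition improved W B (tau : R) mu v : I :=
  if [pick nu : {ffun I -> I} | worthwhile W B tau mu nu] is Some nu
  then nu v else mu v.

Lemma improvableI W B tau mu nu : worthwhile W B tau mu nu -> improvable W B tau mu.
Proof.
move=> nu_ok; apply/existsP; exists [ffun v => nu v].
suff -> : worthwhile W B tau mu [ffun v => nu v] = worthwhile W B tau mu nu by [].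
congr (_ && (tau <= _)); last by apply: eq_bigr => v _; rewrite ffunE.
by apply: eq_forallb_in => v _; rewrite !ffunE.
Qed.

Lemma improvedP W B tau mu : improvable W B tau mu ->
  change_within W B mu (improved W B tau mu) /\
  tau <= gain_within W B mu (improved W B tau mu).
Proof.
case/existsP=> nu0 nu0_ok; rewrite /improved.
by case: pickP => [nu /andP[]|/(_ nu0)/=]; last by rewrite nu0_ok.
Qed.

(* Makes the steps with s below all weights of B idle, whatever happens elsewhere in
   the graph. *)
Definition active W B (s : R) : bool :=
  [exists x in B, [exists y, (0 < W x y) && (W x y <= s)]].

Section Congruence.
Variables (W W' : I -> I -> R) (B : {set I}) (mu mu' : I -> I).
Hypothesis WW' : {in B, forall v, W v =1 W' v}.

Lemma eq_active s : active W B s = active W' B s.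
Proof. by apply: eq_existsb_in => x xB; apply: eq_existsb => y; rewrite WW'. Qed.

Hypothesis mumu' : {in B, mu =1 mu'}.

Lemma eq_worthwhile tau nu : worthwhile W B tau mu nu = worthwhile W' B tau mu' nu.
Proof.
congr (_ && (tau <= _)).
  by apply: eq_forallb_in => v vB; rewrite mumu' // /link WW'.
by apply: eq_bigr => v vB; rewrite mumu' // !WW'.
Qed.

Lemma eq_improvable tau : improvable W B tau mu = improvable W' B tau mu'.
Proof. by apply: eq_existsb => nu; apply: eq_worthwhile. Qed.

Lemma eq_improved tau v :
  mu v = mu' v -> improved W B tau mu v = improved W' B tau mu' v.
Proof.
move=> mu_v; rewrite /improved.
rewrite (eq_pick (fun nu : {ffun I -> I} => eq_worthwhile tau nu)).
by case: pickP.
Qed.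

End Congruence.

Definition movers W rho S tau s mu : {set I} :=
  [set u in S | active W (ball (link W) rho u) s &
                improvable W (ball (link W) rho u) tau mu].

Definition step W rho S tau s mu v : I :=
  if [pick u in movers W rho S tau s mu | u \in ball (link W) rho v] is Some u
  then improved W (ball (link W) rho u) tau mu v else mu v.

Definition disjoint_balls (e : rel I) rho S : Prop :=
  {in S &, forall u u' v, v \in ball e rho u -> v \in ball e rho u' -> u = u'}.

Section Step.
Variables (W : I -> I -> R) (rho : nat) (S : {set I}) (tau s : R) (mu : I -> I).
Hypotheses (symW : commutative W) (disjS : disjoint_balls (link W) rho S).
Hypothesis mu_pairing : pairing W mu.

Let B u := ball (link W) rho u.
Let A := movers W rho S tau s mu.
Let mu' := step W rho S tau s mu.

Let symB u v : (v \in B u) = (u \in B v).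
Proof. exact: ball_sym (link_sym symW). Qed.

Let mover_uniq u u' v : u \in A -> u' \in A -> v \in B u -> v \in B u' -> u = u'.
Proof.
by rewrite !inE => /and3P[uS _ _] /and3P[u'S _ _]; apply: disjS.
Qed.

Let moverP u : u \in A -> change_within W (B u) mu (improved W (B u) tau mu) /\
  tau <= gain_within W (B u) mu (improved W (B u) tau mu).
Proof. by rewrite inE => /and3P[_ _]; apply: improvedP. Qed.

Lemma step_in_ball u v : u \in A -> v \in B u -> mu' v = improved W (B u) tau mu v.
Proof.
move=> uA vu; rewrite /mu' /step; case: pickP => [u' /andP[u'A u'v]|/(_ u)].
  by rewrite (@mover_uniq u u' v) // symB.
by rewrite -symB [v \in _]vu [u \in _]uA.
Qed.

Lemma step_off_balls v : {in A, forall u, v \notin B u} -> mu' v = mu v.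
Proof.
move=> offA; rewrite /mu' /step; case: pickP => // u /andP[uA uv].
by have := offA _ uA; rewrite symB uv.
Qed.

Lemma step_changed v : mu' v != mu v -> exists2 u, u \in A & v \in B u.
Proof.
move=> changed; apply/exists_inP; apply: contraNT changed => /exists_inPn offA.
by apply/eqP/step_off_balls => u uA; apply: offA.
Qed.

Lemma step_boundary v :
  {in A, forall u, v \in B u -> mu v \notin B u} -> mu' v = mu v.
Proof.
move=> boundary; have [/exists_inP[u uA vu]|] := boolP [exists u in A, v \in B u].
  rewrite (step_in_ball uA vu); have [change _] := moverP uA.
  exact: change_within_boundary change vu (boundary u uA vu).
by move/exists_inPn => offA; apply: step_off_balls => u uA; apply: offA.
Qed.

Lemma step_pairing : pairing W mu'.
Proof.
have [muK mu_link] := pairingP _ _ mu_pairing.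
suff mu'_ok v : mu' (mu' v) = v /\ (mu' v = v \/ 0 < W v (mu' v)).
  by apply/pairingP; split=> v; have [] := mu'_ok v.
have [/exists_inP[u uA /andP[vu mu_vu]]|/exists_inPn crossing] :=
    boolP [exists u in A, (v \in B u) && (mu v \in B u)].
  have [change _] := moverP uA.
  have [nu_vu nuK nu_link] := change_within_inside change vu mu_vu.
  by rewrite (step_in_ball uA vu) (step_in_ball uA nu_vu).
have mu'v : mu' v = mu v.
  by apply: step_boundary => u uA vu; have := crossing u uA; rewrite vu.
rewrite mu'v; split=> //; rewrite step_boundary ?muK // => u uA mu_vu.
by have := crossing u uA; rewrite mu_vu andbT.
Qed.

Lemma step_weight : pairing_weight W mu + tau * #|A|%:R <= pairing_weight W mu'.
Proof.
rewrite -lerBrDl /pairing_weight -sumrB.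
have -> : \sum_v (W v (mu' v) - W v (mu v)) =
    \sum_(u in A) gain_within W (B u) mu mu'.
  rewrite (exchange_big_dep xpredT) //=; apply: eq_bigr => v _.
  have [/exists_inP[u uA vu]|/exists_inPn offA] := boolP [exists u in A, v \in B u].
    rewrite (big_pred1 u) // => u'; apply/andP/eqP => [[u'A vu']|-> //].
    exact: mover_uniq u'A uA vu' vu.
  rewrite step_off_balls // subrr big_pred0 // => u.
  by apply/negbTE/negP => /andP[/offA/negP].
rewrite mulr_natr -sumr_const; apply: ler_sum => u uA.
have [_ gain_ge] := moverP uA; apply: le_trans gain_ge _.
rewrite le_eqVlt; apply/predU1P; left.
by apply: eq_bigr => v vu; rewrite (step_in_ball uA).
Qed.

End Step.

End LocalChanges.

Section WeightBounds.
Variables (R : realDomainType) (I : finType) (W : I -> I -> R).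
Hypothesis W_ge0 : forall u v, 0 <= W u v.

Lemma gain_within_le_card B mu nu :
  (forall u v, W u v <= 1) -> gain_within W B mu nu <= #|B|%:R.
Proof.
move=> W_le1; rewrite -sum1_card natr_sum; apply: ler_sum => v _.
by have := W_le1 v (nu v); have := W_ge0 v (mu v); lra.
Qed.

Lemma gain_within_gt0_link B mu nu :
  change_within W B mu nu -> 0 < gain_within W B mu nu ->
  exists x y, [/\ x \in B, y \in B & 0 < W x y].
Proof.
move=> change gain_gt0.
have /exists_inP[x xB x_gain] : [exists x in B, W x (mu x) < W x (nu x)].
  apply: contraTT gain_gt0 => /exists_inPn no_gain; rewrite -leNgt.
  by apply: sumr_le0 => v /no_gain; rewrite -leNgt subr_le0.
exists x, (nu x); split=> //; last exact: le_lt_trans x_gain.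
have [mu_xB|mu_xB] := boolP (mu x \in B).
  by have [] := change_within_inside change xB mu_xB.
by move: x_gain; rewrite (change_within_boundary change xB mu_xB) ltxx.
Qed.

Lemma max_pairing_covers opt x y :
  commutative W -> (forall v, W v v = 0) -> max_pairing W opt ->
  0 < W x y -> exists2 z, z \in [set x; y] & 0 < W z (opt z).
Proof.
move=> symW W_diag [/pairingP[optK opt_link] opt_max] xy.
have neq_xy : x != y by apply: contraTneq xy => ->; rewrite W_diag ltxx.
have [opt_x|] := opt_link x; last by exists x; rewrite ?set21.
have [opt_y|] := opt_link y; last by exists y; rewrite ?set22.
pose mu v := if v == x then y else if v == y then x else opt v.
have mu_x : mu x = y by rewrite /mu eqxx.
have mu_y : mu y = x by rewrite /mu eqxx eq_sym (negPf neq_xy).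
have mu_opt v : v != x -> v != y -> mu v = opt v.
  by move=> vx vy; rewrite /mu (negPf vx) (negPf vy).
have mu_pairing : pairing W mu.
  apply/pairingP; split=> v;
    (have [->|vx] := eqVneq v x; last have [->|vy] := eqVneq v y).
  - by rewrite mu_x mu_y.
  - by rewrite mu_y mu_x.
  - by rewrite (mu_opt v) // mu_opt ?optK // (inv_eq optK) ?opt_x ?opt_y.
  - by right; rewrite mu_x.
  - by right; rewrite mu_y symW.
  - by rewrite mu_opt.
have := opt_max _ mu_pairing; rewrite leNgt => /negP[].
rewrite /pairing_weight (bigD1 x) //= [ltRHS](bigD1 x) //= opt_x mu_x W_diag.
apply: ltr_leD => //; apply: ler_sum => v vx; have [->|vy] := eqVneq v y.
  by rewrite opt_y W_diag.
by rewrite mu_opt.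
Qed.

End WeightBounds.

(** * Alternating walks *)

Lemma sum_ltn n m : (\sum_(t < n) (t < m) = minn n m)%N.
Proof.
elim: n => [|n IH]; first by rewrite big_ord0 min0n.
by rewrite big_ord_recr /= IH; case: ltnP; lia.
Qed.

Section AlternatingWalks.
Variables (R : realFieldType) (I : finType) (W : I -> I -> R) (k rho : nat).
Variables mu opt : I -> I.
Hypotheses (W_diag : forall v, W v v = 0) (W_ge0 : forall u v, 0 <= W u v).
Hypotheses (mu_pairing : pairing W mu) (opt_pairing : pairing W opt).
Hypothesis k_rho : (k.*2 <= rho)%N.
Implicit Types u v : I.

Let muK : involutive mu. Proof. by case/pairingP: mu_pairing. Qed.
Let optK : involutive opt. Proof. by case/pairingP: opt_pairing. Qed.
Let mu_link v : mu v = v \/ 0 < W v (mu v).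
Proof. by case/pairingP: mu_pairing. Qed.

Let opt_link v : opt v = v \/ 0 < W v (opt v).
Proof. by case/pairingP: opt_pairing. Qed.

Definition walk i u : I := iter i (mu \o opt) u.

Definition visits n u v : nat := \sum_(i < n) (walk i u == v).

(* How often the walk of length k from u uses the edge of opt at v. *)
Definition multiplicity u v : nat := visits k u v + visits k u (opt v).

(* The change which switches to opt along the edges used more than t times. *)
Definition layer u t v : I :=
  if (t < multiplicity u v)%N then opt v
  else if (t < multiplicity u (mu v))%N then v else mu v.

Lemma walk_ball i u : walk i u \in ball (link W) i.*2 u.
Proof.
elim: i => [|i IH]; first exact: ball_refl.
rewrite /walk iterS doubleS -addn2; apply: ball_trans IH _.
apply: (@ball_trans _ _ 1 1 _ _ _ (pairing_ball _ opt_pairing)).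
exact: pairing_ball.
Qed.

Lemma visits_gt0 n u v :
  (0 < visits n u v)%N -> exists2 i, (i < n)%N & walk i u = v.
Proof.
rewrite lt0n sum_nat_eq0 negb_forall => /existsP[i].
by rewrite /= eqb0 negbK => /eqP <-; exists i.
Qed.

Lemma multiplicity_opt u v : multiplicity u (opt v) = multiplicity u v.
Proof. by rewrite /multiplicity optK addnC. Qed.

Lemma multiplicity_ball u v :
  (0 < multiplicity u v)%N -> v \in ball (link W) k.*2.-1 u.
Proof.
rewrite addn_gt0 => /orP[] /visits_gt0[i ik walk_v].
  by apply: (@ball_leq _ _ i.*2); [lia|rewrite -walk_v walk_ball].
rewrite -(optK v) -walk_v; apply: (@ball_leq _ _ (i.*2 + 1)); first by lia.
by apply: ball_trans (walk_ball i u) _; apply: pairing_ball.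
Qed.

Lemma multiplicity_mu_ball u v :
  (0 < multiplicity u (mu v))%N -> v \in ball (link W) rho u.
Proof.
move=> mult_gt0; have k_gt0 : (0 < k)%N.
  by case: (posnP k) mult_gt0 => // k0; rewrite /multiplicity /visits k0 !big_ord0.
rewrite -(muK v); apply: (@ball_leq _ _ (k.*2.-1 + 1)); first by lia.
by apply: ball_trans (multiplicity_ball mult_gt0) _; apply: pairing_ball.
Qed.

Lemma multiplicity_le u v : (multiplicity u v <= k.*2)%N.
Proof.
have visits_le w : (visits k u w <= k)%N.
  rewrite -[leqRHS]muln1 -[X in (X * 1)%N]card_ord -sum_nat_const.
  by apply: leq_sum => i _; case: eqP.
by rewrite -addnn leq_add.
Qed.

Lemma layer_change u t : change_within W (ball (link W) rho u) mu (layer u t).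
Proof.
apply/forall_inP => v vu; rewrite /layer; case: (ltnP t) => t_v.
  have opt_vu : opt v \in ball (link W) k.*2.-1 u.
    by apply: multiplicity_ball; rewrite multiplicity_opt; lia.
  have -> : mu v \in ball (link W) rho u.
    by apply: multiplicity_mu_ball; rewrite muK; lia.
  rewrite multiplicity_opt t_v optK eqxx (ball_leq _ opt_vu) /=; last by lia.
  exact/predU1P/opt_link.
case: (ltnP t) => t_mu.
  rewrite ltnNge t_v /= t_mu vu !eqxx /=.
  have -> // : mu v \in ball (link W) rho u.
  by apply: (ball_leq _ (multiplicity_ball _)); lia.
case: ifP => // ->; rewrite ltnNge t_mu /= muK ltnNge t_v /= eqxx /=.
exact/predU1P/mu_link.
Qed.

Lemma layer_gain u t : gain_within W (ball (link W) rho u) mu (layer u t) =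
  \sum_v ((t < multiplicity u v)%N%:R * W v (opt v)
     - ((t < multiplicity u v) || (t < multiplicity u (mu v)))%N%:R * W v (mu v)).
Proof.
rewrite /gain_within big_mkcond; apply: eq_bigr => v _; rewrite /layer.
case: (ltnP t) => t_v /=.
  by rewrite (ball_leq _ (multiplicity_ball _)) ?mul1r //; lia.
case: (ltnP t) => t_mu; last by rewrite subrr if_same !mul0r subrr.
by rewrite multiplicity_mu_ball ?W_diag ?mul0r ?mul1r //; lia.
Qed.

Lemma visits_opt u v : (visits k u (opt v) <= visits k.+1 u (mu v))%N.
Proof.
rewrite /visits big_ord_recl /=; apply: leq_trans (leq_addl _ _).
apply: leq_sum => i _; case: (altP (walk i u =P opt v)) => // walk_v.
by rewrite -/(walk i u) walk_v optK eqxx.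
Qed.

Lemma visitsS u v : (visits k u v <= visits k.+1 u v)%N.
Proof. by rewrite /visits big_ord_recr leq_addr. Qed.

Lemma sum_layer_gain u :
  \sum_(t < k.*2) gain_within W (ball (link W) rho u) mu (layer u t) >=
  \sum_v ((multiplicity u v)%:R * W v (opt v)
     - (visits k.+1 u v + visits k.+1 u (mu v))%:R * W v (mu v)).
Proof.
under [leRHS]eq_bigr do rewrite layer_gain.
rewrite exchange_big /=; apply: ler_sum => v _.
rewrite sumrB -!mulr_suml -!natr_sum sum_ltn (minn_idPr (multiplicity_le u v)).
rewrite lerD2l lerN2 ler_wpM2r // ler_nat.
set m := (_ + _)%N; apply: (@leq_trans (\sum_(t < k.*2) (t < m))%N); last first.
  by rewrite sum_ltn geq_minr.
have mult_v : (multiplicity u v <= m)%N.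
  exact: leq_add (visitsS _ _) (visits_opt _ _).
have mult_mu : (multiplicity u (mu v) <= m)%N.
  rewrite /m addnC; apply: leq_add (visitsS _ _) _.
  by rewrite -[X in (_ <= visits _ _ X)%N]muK visits_opt.
apply: leq_sum => t _; case: (ltnP t m) => t_m; first by case: (_ || _).
by rewrite !ltnNge (leq_trans mult_v) // (leq_trans mult_mu).
Qed.

Lemma sum_visits n v : (\sum_u visits n u v = n)%N.
Proof.
rewrite exchange_big /= -[RHS]muln1 -[X in (X * 1)%N]card_ord -sum_nat_const.
apply: eq_bigr => i _; rewrite -big_mkcond /= sum1_card.
have walk_inj : injective (walk i).
  elim: (i : nat) => [//|j IH] x y; rewrite /walk !iterS.
  by move=> /(inv_inj muK)/(inv_inj optK)/IH.
have [g walkK gK] := injF_bij walk_inj.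
rewrite -(card1 (g v)); apply: eq_card => u; rewrite !inE.
by apply/eqP/eqP => [<-|->]; rewrite ?walkK ?gK.
Qed.

(* Summing over all starting points, every vertex lies on 2k of the walks of length
   k; a walk reflects at the ends of the alternating paths because mu \o opt is a
   permutation, so no end effects arise. *)
Lemma sum_local_gain_ge (h : I -> R) : (0 < k)%N ->
  (forall u nu, change_within W (ball (link W) rho u) mu nu ->
     gain_within W (ball (link W) rho u) mu nu <= h u) ->
  pairing_weight W opt - (1 + k%:R^-1) * pairing_weight W mu <= \sum_u h u.
Proof.
move=> k_gt0 gain_le; rewrite -(@ler_pM2l _ k.*2%:R) ?ltr0n ?double_gt0 //.
have -> : k.*2%:R * (pairing_weight W opt - (1 + k%:R^-1) * pairing_weight W mu) =
    k.*2%:R * pairing_weight W opt - k.+1.*2%:R * pairing_weight W mu.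
  by rewrite -!mul2n !natrM -natr1; field; rewrite pnatr_eq0 -lt0n.
apply: (@le_trans _ _ (\sum_u \sum_(t < k.*2)
          gain_within W (ball (link W) rho u) mu (layer u t))); last first.
  rewrite mulr_sumr; apply: ler_sum => u _.
  rewrite mulr_natl -[X in _ *+ X]card_ord -sumr_const.
  by apply: ler_sum => t _; apply/gain_le/layer_change.
apply: le_trans (ler_sum _ (fun u _ => sum_layer_gain u)).
rewrite exchange_big /= /pairing_weight !mulr_sumr -sumrB; apply: ler_sum => v _.
by rewrite sumrB -!mulr_suml -!natr_sum !big_split /= !sum_visits !addnn.
Qed.

End AlternatingWalks.

(** * Sweeps *)

Section Thresholds.
Variables (R : realFieldType) (T0 : R).

Definition threshold j : R := T0 / 2 ^+ j.

Lemma thresholdS j : threshold j = 2 * threshold j.+1.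
Proof. by rewrite /threshold exprS invfM mulrCA mulVKf ?pnatr_eq0. Qed.

Hypothesis T0_ge0 : 0 <= T0.

Lemma threshold_ge0 j : 0 <= threshold j.
Proof. by rewrite divr_ge0 ?exprn_ge0. Qed.

Lemma threshold_le i j : (i <= j)%N -> threshold j <= threshold i.
Proof.
move=> ij; rewrite ler_wpM2l // lef_pV2 ?posrE ?exprn_gt0 //.
by rewrite ler_weXn2l // ler1n.
Qed.

Lemma threshold_bracket n x : threshold n <= x <= T0 ->
  exists2 j, (j <= n)%N & threshold j <= x <= 2 * threshold j.
Proof.
case/andP=> n_x x_T0; have thr_x : exists j, threshold j <= x by exists n.
case: (ex_minnP thr_x) => j j_x j_min; exists j; rewrite ?j_min // j_x /=.
case: j j_x j_min => [|j] j_x j_min.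
  by rewrite /threshold expr0 divr1; move: T0_ge0; lra.
by rewrite -thresholdS leNgt; apply/negP => /ltW/j_min; rewrite ltnn.
Qed.

End Thresholds.

Lemma sum_card_incidence (I J : finType) (A : {set I}) (B : I -> {set J}) :
  (\sum_j #|[set i in A | j \in B i]| = \sum_(i in A) #|B i|)%N.
Proof.
under eq_bigr => j _ do (rewrite -sum1_card; under eq_bigl => i do rewrite inE).
rewrite (exchange_big_dep (mem A)) => [|j i _ /andP[]//] /=.
by apply: eq_bigr => i iA; rewrite -sum1_card; apply: eq_bigl => j; rewrite iA.
Qed.

Section DistanceColouring.
Variables (I : finType) (e : rel I).

Definition distance_colouring t (col : I -> nat) : Prop :=
  forall u v, v \in ball e t u -> col u = col v -> u = v.

Lemma disjoint_balls_colour rho col c :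
  symmetric e -> distance_colouring rho.*2 col ->
  disjoint_balls e rho [set u | col u == c].
Proof.
move=> e_sym colP u u'; rewrite !inE => /eqP uc /eqP u'c v vu vu'.
apply: colP; last by rewrite uc u'c.
by rewrite -addnn; apply: ball_trans vu _; rewrite ball_sym.
Qed.

End DistanceColouring.

Lemma harmonic_decay (R : realFieldType) (y : nat -> R) (N : nat) (X : R) :
  0 <= X -> (0 < N)%N -> y 0%N <= X ->
  (forall t, y t.+1 * N%:R <= y t * (N%:R - 1)) ->
  forall t, y t * (N + t)%:R <= N%:R * X.
Proof.
move=> X_ge0 N_gt0 y0 y_decay.
have N_ge1 : 1 <= N%:R :> R by rewrite ler1n.
have y_le t : y t <= X.
  elim: t => // t IH; rewrite -(@ler_pM2r _ N%:R) ?ltr0n //.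
  by apply: le_trans (y_decay t) _; nra.
elim=> [|t IH]; first by rewrite addn0 mulrC ler_wpM2l // ler0n.
have yS : y t.+1 * (N + t)%:R <= (N%:R - 1) * X.
  rewrite -(@ler_pM2r _ N%:R) ?ltr0n // mulrAC.
  apply: (@le_trans _ _ (y t * (N%:R - 1) * (N + t)%:R)).
    by rewrite ler_wpM2r.
  by have := ler_wpM2l (_ : 0 <= N%:R - 1) IH; rewrite subr_ge0 => /(_ N_ge1); lra.
by have := y_le t.+1; rewrite addnS -natr1 mulrDr mulr1; lra.
Qed.

(* The deficit (1 - d) X - (1 + c) (x t) shrinks by the factor 1 - 1/N per step. *)
Lemma ratio_of_progress (R : realFieldType) (x : nat -> R) (N m : nat) (X c d : R) :
  0 <= X -> 0 <= c -> 0 < d -> (0 < N)%N -> N%:R <= d * m%:R -> 0 <= x 0%N ->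
  (forall t, x t <= x t.+1) ->
  (forall t, (1 - d) * X - (1 + c) * x t <= N%:R * (x t.+1 - x t)) ->
  (1 - 2 * d) * X <= (1 + c) * x m.
Proof.
move=> X_ge0 c_ge0 d_gt0 N_gt0 m_large x0_ge0 x_mono progress.
pose y t := (1 - d) * X - (1 + c) * x t.
have dX : 0 <= d * X by rewrite mulr_ge0 // ltW.
have N_ge0 : 0 <= N%:R :> R by [].
have y0 : y 0%N <= X by have := mulr_ge0 c_ge0 x0_ge0; rewrite /y; lra.
have y_decay t : y t.+1 * N%:R <= y t * (N%:R - 1).
  have := progress t; rewrite -/(y t).
  have -> : y t.+1 = y t - (1 + c) * (x t.+1 - x t) by rewrite /y; ring.
  have : 0 <= c * N%:R * (x t.+1 - x t) by rewrite !mulr_ge0 ?subr_ge0.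
  lra.
suff : y m <= d * X by rewrite /y; lra.
have [y_le0|y_gt0] := leP (y m) 0; first exact: le_trans dX.
have m_gt0 : 0 < m%:R :> R.
  by rewrite -(pmulr_rgt0 _ d_gt0) (lt_le_trans _ m_large) // ltr0n.
have := harmonic_decay X_ge0 N_gt0 y0 y_decay m; rewrite natrD => y_bound.
rewrite -(ler_pM2r m_gt0); have := ler_wpM2r X_ge0 m_large.
have := mulr_ge0 (ltW y_gt0) N_ge0; lra.
Qed.

Section Sweep.
Variables (R : realFieldType) (I : finType) (W : I -> I -> R) (rho C : nat).
Variables (col : I -> nat) (T0 theta : R).

Fixpoint sweep i (mu : I -> I) : I -> I :=
  if i is i'.+1 then
    step W rho [set u | col u == i' %% C]%N (threshold T0 (i' %/ C))
      (threshold T0 (i' %/ C) / theta) (sweep i' mu)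
  else mu.

Section Charging.
Hypotheses (symW : commutative W) (T0_ge0 : 0 <= T0).
Hypothesis col_distance : distance_colouring (link W) rho.*2 col.
Variable mu : I -> I.
Hypothesis mu_pairing : pairing W mu.

Local Notation B u := (ball (link W) rho u).
Local Notation tau i := (threshold T0 (i %/ C)).

Let class_disjoint c : disjoint_balls (link W) rho [set u | col u == c].
Proof. exact: disjoint_balls_colour (link_sym symW) col_distance. Qed.

Let movers_at i : {set I} :=
  movers W rho [set u | col u == i %% C]%N (tau i) (tau i / theta) (sweep i mu).

Lemma sweep_pairing i : pairing W (sweep i mu).
Proof. by elim: i => //= i; apply: step_pairing _ _ symW (@class_disjoint _). Qed.

Lemma sweep_weightS i :
  pairing_weight W (sweep i mu) + tau i * #|movers_at i|%:R
    <= pairing_weight W (sweep i.+1 mu).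
Proof. exact: step_weight _ _ _ symW (@class_disjoint _). Qed.

Lemma sweep_weight_ge i : pairing_weight W mu <= pairing_weight W (sweep i mu).
Proof.
elim: i => // i IH; apply: le_trans IH (le_trans _ (sweep_weightS i)).
by rewrite lerDl mulr_ge0 ?threshold_ge0.
Qed.

(* A change made by a mover is charged to all the centres whose balls it may
   affect. *)
Definition charge i u : R :=
  tau i * #|[set u' in movers_at i | u \in ball (link W) rho.*2 u']|%:R.

Lemma charge_ge0 i u : 0 <= charge i u.
Proof. by rewrite mulr_ge0 ?threshold_ge0. Qed.

Lemma charge_ge_threshold i u u' :
  u' \in movers_at i -> u \in ball (link W) rho.*2 u' -> tau i <= charge i u.
Proof.
move=> u'A uu'; rewrite /charge ler_peMr ?threshold_ge0 // ler1n.
by apply/card_gt0P; exists u'; rewrite inE u'A.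
Qed.

Lemma sum_charge b n : (forall v, #|link W v| < b)%N ->
  \sum_u \sum_(i < n) charge i u <=
    (b ^ rho.*2)%:R * (pairing_weight W (sweep n mu) - pairing_weight W mu).
Proof.
move=> degW; rewrite exchange_big /=; elim: n => [|n IH].
  by rewrite big_ord0 subrr mulr0.
have charge_n : \sum_u charge n u <= (b ^ rho.*2)%:R *
    (pairing_weight W (sweep n.+1 mu) - pairing_weight W (sweep n mu)).
  apply: (@le_trans _ _ ((b ^ rho.*2)%:R * (tau n * #|movers_at n|%:R)));
    last by apply: ler_wpM2l => //; rewrite lerBrDl sweep_weightS.
  rewrite -mulr_sumr mulrCA ler_wpM2l ?threshold_ge0 // -natr_sum -natrM ler_nat.
  rewrite sum_card_incidence mulnC -sum_nat_const; apply: leq_sum => u' _.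
  exact: card_ball.
by rewrite big_ord_recr /=; move: IH charge_n; rewrite !mulrBr; lra.
Qed.

Lemma sweep_unchanged_or_charged u n :
  {in B u, sweep n mu =1 mu} \/ exists2 i, (i < n)%N & tau i <= charge i u.
Proof.
elim: n => [|n [same|[i i_n charged]]]; first by left.
  have [/exists_inP[v vu changed]|/exists_inPn still] :=
      boolP [exists v in B u, sweep n.+1 mu v != sweep n mu v].
    right; exists n => //; have [u' u'A vu'] := step_changed symW changed.
    apply: charge_ge_threshold u'A _; rewrite -addnn; apply: ball_trans vu' _.
    by rewrite ball_sym //; apply: link_sym.
  by left=> v vu; have /negPn/eqP-> := still v vu; apply: same.
by right; exists i => //; apply: ltnW.
Qed.

Lemma threshold_le_charges J u j nu : (forall v, col v < C)%N -> (j < J)%N ->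
  active W (B u) (threshold T0 j / theta) ->
  change_within W (B u) mu nu -> threshold T0 j <= gain_within W (B u) mu nu ->
  threshold T0 j <= \sum_(i < J * C) charge i u.
Proof.
move=> col_lt jJ u_active change gain_ge.
have C_gt0 : (0 < C)%N by apply: leq_ltn_trans (col_lt u).
pose i0 := (j * C + col u)%N.
have i0_div : (i0 %/ C)%N = j by rewrite divnMDl // divn_small ?addn0.
have i0_mod : (i0 %% C)%N = col u by rewrite modnMDl modn_small.
have i0_lt : (i0 < J * C)%N by rewrite /i0; have := col_lt u; nia.
suff [i i_i0 charged] : exists2 i, (i <= i0)%N & threshold T0 j <= charge i u.
  have iJ : (i < J * C)%N by lia.
  rewrite (bigD1 (Ordinal iJ)) //=; apply: le_trans charged _.
  by rewrite lerDl sumr_ge0 // => ? _; apply: charge_ge0.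
have [same|[i i_i0 charged]] := sweep_unchanged_or_charged u i0; last first.
  exists i; first exact: ltnW.
  apply: le_trans charged; apply: threshold_le => //.
  by rewrite -i0_div leq_div2r // ltnW.
exists i0 => //; rewrite -{1}i0_div.
apply: (@charge_ge_threshold _ _ u); last exact: ball_refl.
rewrite !inE i0_mod i0_div eqxx u_active.
rewrite (eq_improvable (fun v _ => frefl (W v)) same).
by apply: (@improvableI _ _ _ _ _ _ nu); rewrite /worthwhile change.
Qed.

End Charging.

Section LocalSearch.
Variables (b J : nat).
Hypotheses (symW : commutative W) (W_diag : forall v, W v v = 0).
Hypotheses (W_ge0 : forall u v, 0 <= W u v) (W_le1 : forall u v, W u v <= 1).
Hypothesis degW : forall v, (#|link W v| < b)%N.
Hypothesis col_distance : distance_colouring (link W) rho.*2 col.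
Hypotheses (col_lt : forall v, (col v < C)%N) (theta_gt0 : 0 < theta).
Hypothesis T0_ge : (b ^ rho)%:R <= T0.
Hypothesis bottom_threshold :
  forall u v, 0 < W u v -> threshold T0 J <= theta * W u v.

Let T0_ge0 : 0 <= T0. Proof. exact: le_trans T0_ge. Qed.

Section Progress.
Variables mu opt : I -> I.
Hypotheses (mu_pairing : pairing W mu) (opt_max : max_pairing W opt).

Lemma local_gain_le_charges u nu :
  change_within W (ball (link W) rho u) mu nu ->
  gain_within W (ball (link W) rho u) mu nu <=
    2 * \sum_(i < J * C) charge mu i u
    + 2 * theta * \sum_(z in ball (link W) rho u) W z (opt z).
Proof.
set X := \sum_(i < _) _; set Y := \sum_(z in _) _.
set g := gain_within _ _ _ _ => change.
have X_ge0 : 0 <= X by apply: sumr_ge0 => i _; apply: charge_ge0.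
have Y_ge0 : 0 <= theta * Y by rewrite mulr_ge0 ?sumr_ge0 // ltW.
have [g_le0|g_gt0] := leP g 0; first by lra.
have [x [y [xu yu xy]]] := gain_within_gt0_link W_ge0 change g_gt0.
have [z zxy z_opt] := max_pairing_covers W_ge0 symW W_diag opt_max xy.
have zu : z \in ball (link W) rho u by move: zxy; rewrite !inE => /orP[] /eqP->.
have z_Y : theta * W z (opt z) <= theta * Y.
  by rewrite ler_pM2l // /Y (bigD1 z) //= lerDl; apply: sumr_ge0.
have z_bottom := bottom_threshold z_opt.
have [g_bottom|g_bottom] := ltP g (threshold T0 J); first by lra.
have g_top : g <= T0.
  apply: le_trans T0_ge.
  apply: le_trans (gain_within_le_card W_ge0 _ _ _ W_le1) _.
  by rewrite ler_nat card_ball.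
have [|j jJ /andP[j_g g_j]] := @threshold_bracket _ _ T0_ge0 J g.
  by rewrite g_bottom.
have [j_z|z_j] := leP (threshold T0 j) (theta * W z (opt z)); first by lra.
suff : threshold T0 j <= X by lra.
apply: threshold_le_charges change j_g => //.
  by rewrite ltn_neqAle jJ andbT; apply: contraTneq z_j => ->; rewrite -leNgt.
apply/exists_inP; exists z => //; apply/existsP; exists (opt z).
by rewrite z_opt ler_pdivlMr // mulrC ltW.
Qed.

Lemma sum_ball_weight_le :
  \sum_u \sum_(z in ball (link W) rho u) W z (opt z)
    <= (b ^ rho)%:R * pairing_weight W opt.
Proof.
rewrite (exchange_big_dep xpredT) //= mulr_sumr; apply: ler_sum => z _.
rewrite sumr_const -[leLHS]mulr_natl ler_wpM2r // ler_nat.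
rewrite (leq_trans _ (card_ball rho z degW)) //.
apply/subset_leq_card/subsetP => u; rewrite -topredE /= ball_sym //.
exact: link_sym.
Qed.

Lemma sweep_progress k : (0 < k)%N -> (k.*2 <= rho)%N ->
  (1 - 2 * theta * (b ^ rho)%:R) * pairing_weight W opt
    - (1 + k%:R^-1) * pairing_weight W mu
  <= 2 * (b ^ rho.*2)%:R *
     (pairing_weight W (sweep (J * C) mu) - pairing_weight W mu).
Proof.
move=> k_gt0 k_rho.
have := sum_local_gain_ge W_diag W_ge0 mu_pairing (proj1 opt_max) k_rho k_gt0
          local_gain_le_charges.
rewrite big_split -!mulr_sumr /=.
have := sum_charge symW T0_ge0 col_distance mu (J * C) degW.
have : 2 * theta * \sum_u \sum_(z in ball (link W) rho u) W z (opt z)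
    <= 2 * theta * ((b ^ rho)%:R * pairing_weight W opt).
  by rewrite ler_wpM2l ?sum_ball_weight_le // mulr_ge0 // ltW.
lra.
Qed.

End Progress.

Definition local_search m : I -> I := iter m (sweep (J * C)) id.

Lemma local_search_pairing m : pairing W (local_search m).
Proof. by elim: m => [|m IH]; [exact: pairing_id|exact: sweep_pairing]. Qed.

Variable q : nat.
Hypotheses (q_gt0 : (0 < q)%N) (b_gt0 : (0 < b)%N).
Hypothesis rho_large : ((4 * q).*2 <= rho)%N.
Hypothesis theta_small : theta * (16 * q * b ^ rho)%:R <= 1.

Let q_ge1 : 1 <= q%:R :> R. Proof. by rewrite ler1n. Qed.

Lemma local_search_progress opt m : max_pairing W opt ->
  (1 - (8 * q%:R)^-1) * pairing_weight W opt
    - (1 + 2 / (8 * q%:R)) * pairing_weight W (local_search m)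
  <= (2 * b ^ rho.*2)%:R *
     (pairing_weight W (local_search m.+1) - pairing_weight W (local_search m)).
Proof.
move=> opt_max.
have := sweep_progress (local_search_pairing m) opt_max _ rho_large.
have -> : (4 * q)%:R^-1 = 2 / (8 * q%:R) :> R.
  by rewrite natrM; field; have := q_ge1; lra.
rewrite muln_gt0 q_gt0 natrM => /(_ isT); apply: le_trans.
rewrite lerD2r ler_wpM2r ?sumr_ge0 // lerD2l lerN2.
rewrite -[leRHS]mul1r ler_pdivlMr; last by have := q_ge1; lra.
by apply: le_trans theta_small; rewrite !natrM; lra.
Qed.

Lemma local_search_approx m nu : (16 * q * b ^ rho.*2 <= m)%N -> pairing W nu ->
  (1 - (2 * q%:R)^-1) * pairing_weight W nu <= pairing_weight W (local_search m).
Proof.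
move=> m_large nu_pairing; have [opt opt_max] := max_pairing_exists W.
have [_ le_opt] := opt_max; set X := pairing_weight W opt in le_opt *.
pose x t := pairing_weight W (local_search t); pose d : R := (8 * q%:R)^-1.
have weight_ge0 mu : 0 <= pairing_weight W mu by apply: sumr_ge0.
have dq : d * q%:R = 8^-1 by rewrite /d; field; have := q_ge1; lra.
have d_gt0 : 0 < d by rewrite invr_gt0; have := q_ge1; lra.
have d_le : d <= 8^-1 by rewrite -dq ler_peMr // ltW.
have m_ge : (2 * b ^ rho.*2)%:R <= d * m%:R :> R.
  rewrite -(@ler_pM2r _ q%:R) ?ltr0n // mulrAC dq.
  have : (16 * q * b ^ rho.*2)%:R <= m%:R :> R by rewrite ler_nat.
  by rewrite !natrM; lra.
have ratio : (1 - 2 * d) * X <= (1 + 2 * d) * x m.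
  apply: (@ratio_of_progress _ _ (2 * b ^ rho.*2)) m_ge _ _ _ => //.
  - exact: weight_ge0.
  - by rewrite mulr_ge0 // ltW.
  - by rewrite muln_gt0 expn_gt0 b_gt0.
  - exact: weight_ge0.
  - by move=> t; apply: sweep_weight_ge => //; apply: local_search_pairing.
  - by move=> t; apply: local_search_progress.
have -> : (2 * q%:R)^-1 = 4 * d by rewrite /d; field; have := q_ge1; lra.
apply: (@le_trans _ _ ((1 - 4 * d) * X)).
  by rewrite ler_wpM2l ?le_opt //; lra.
have : 0 <= d * (X - x m).
  by rewrite mulr_ge0 ?(ltW d_gt0) // subr_ge0 le_opt // local_search_pairing.
rewrite -/(x m); lra.
Qed.

End LocalSearch.

End Sweep.

(** * Locality *)

Section Locality.
Variables (R : numDomainType) (I : finType) (wm : R).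
Implicit Types (W : I -> I -> R) (T : Type).

Definition local r T (f : (I -> I -> R) -> I -> T) : Prop :=
  forall W W' i, (forall x y, 0 < W x y -> wm <= W x y) ->
  agree W W' r i -> f W i = f W' i.

Lemma local_leq r s T (f : (I -> I -> R) -> I -> T) :
  (r <= s)%N -> local r f -> local s f.
Proof. by move=> rs f_local W W' i W_ge /(agree_leq rs); apply: f_local. Qed.

End Locality.

Section LocalStep.
Variables (R : realDomainType) (I : finType) (wm : R) (rho : nat).
Implicit Types (W : I -> I -> R) (S : (I -> I -> R) -> {set I}).
Implicit Types (F : (I -> I -> R) -> I -> I) (tau s : R).

Lemma step_local r S F tau s :
  local wm r (fun W u => u \in S W) -> local wm r F ->
  local wm (r + rho.*2) (fun W => step W rho (S W) tau s (F W)).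
Proof.
move=> S_local F_local W W' v W_ge WW'; rewrite /step.
have agree_u u : u \in ball (link W) rho v -> agree W W' (rho + r) u.
  by move=> uv; apply: (agree_in_ball uv); apply: agree_leq WW'; lia.
have agree_B u : u \in ball (link W) rho v -> agree W W' rho u.
  by move=> /agree_u; apply: agree_leq; exact: leq_addr.
have F_v : F W v = F W' v by apply: F_local => //; apply: agree_leq WW'; lia.
have F_agree u : u \in ball (link W) rho v -> {in ball (link W) rho u, F W =1 F W'}.
  by move=> /agree_u uWW' x xu; apply: F_local => //; apply: agree_in_ball xu uWW'.
have ball_v : ball (link W) rho v = ball (link W') rho v.
  by apply: agree_ball; apply: agree_leq WW'; lia.
have mover_u u : u \in ball (link W) rho v ->
    (u \in movers W rho (S W) tau s (F W))
    = (u \in movers W' rho (S W') tau s (F W')).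
  move=> uv; rewrite !inE -(agree_ball (agree_B u uv)).
  rewrite (eq_active (agree_B u uv) s).
  rewrite (eq_improvable (agree_B u uv) (F_agree u uv) tau).
  by rewrite (S_local W W' u) //; apply: agree_leq (agree_u u uv); exact: leq_addl.
rewrite (@eq_pick _ _ [pred u in movers W' rho (S W') tau s (F W')
                          | u \in ball (link W') rho v]); last first.
  by move=> u /=; rewrite -ball_v; apply: andb_id2r => /mover_u.
case: pickP => [u /andP[_]|//]; rewrite -ball_v => uv.
rewrite -(agree_ball (agree_B u uv)).
exact: eq_improved (agree_B u uv) (F_agree u uv) tau v F_v.
Qed.

Lemma step_idle_local r S F tau s : s < wm -> (rho.*2 <= r)%N -> local wm r F ->
  local wm r (fun W => step W rho (S W) tau s (F W)).
Proof.
move=> s_wm rho_r F_local W W' v W_ge WW'; rewrite /step.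
have F_v : F W v = F W' v by apply: F_local.
have idle u : active W (ball (link W) rho u) s = false.
  apply/exists_inP => -[x _ /existsP[y /andP[/W_ge wm_W W_s]]].
  by have := le_lt_trans (le_trans wm_W W_s) s_wm; rewrite ltxx.
have ball_v : ball (link W) rho v = ball (link W') rho v.
  by apply: agree_ball; apply: agree_leq WW'; lia.
case: pickP => [u|_]; first by rewrite !inE idle andbF.
case: pickP => // u /andP[]; rewrite !inE -ball_v => /and3P[_ u_active _] uv.
have uWW' : agree W W' rho u.
  by apply: (agree_in_ball uv); apply: agree_leq WW'; lia.
by rewrite -(agree_ball uWW') -(eq_active uWW') idle in u_active.
Qed.

End LocalStep.

Section LocalSweep.
Variables (R : realFieldType) (I : finType) (wm : R) (rho C J Jact : nat).
Variables (col : (I -> I -> R) -> I -> nat) (T0 theta : R).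
Hypotheses (C_gt0 : (0 < C)%N).
Hypothesis idle : forall j, (Jact <= j)%N -> threshold T0 j / theta < wm.

Lemma sweep_local r (F : (I -> I -> R) -> I -> I) i : (rho.*2 <= r)%N ->
  local wm r col -> local wm r F ->
  local wm (r + rho.*2 * minn i (Jact * C))
    (fun W => sweep W rho C (col W) T0 theta i (F W)).
Proof.
move=> rho_r col_local F_local; elim: i => [|i IH].
  by rewrite min0n muln0 addn0.
have class_local c : local wm r (fun W u => u \in [set u | col W u == c]).
  by move=> W W' u W_ge WW'; rewrite !inE (col_local _ _ _ W_ge WW').
have [i_act|i_idle] := ltnP i (Jact * C).
  have -> : (r + rho.*2 * minn i.+1 (Jact * C) =
             r + rho.*2 * minn i (Jact * C) + rho.*2)%N.
    by rewrite (minn_idPl i_act) (minn_idPl (ltnW i_act)) mulnS; lia.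
  by apply: step_local IH; apply: local_leq (class_local _); exact: leq_addr.
have -> : minn i.+1 (Jact * C) = minn i (Jact * C) by lia.
by apply: step_idle_local IH; [apply: idle; rewrite leq_divRL|lia].
Qed.

Lemma local_search_local r m : (rho.*2 <= r)%N -> local wm r col ->
  local wm (r + m * (rho.*2 * (Jact * C)))
    (fun W => local_search W rho C (col W) T0 theta J m).
Proof.
move=> rho_r col_local; elim: m => [//|m IH].
set r' := (r + _)%N in IH.
have -> : (r + m.+1 * (rho.*2 * (Jact * C)) = r' + rho.*2 * (Jact * C))%N.
  by rewrite /r' mulSn addnCA addnC.
apply: local_leq (_ : (r' + rho.*2 * minn (J * C) (Jact * C) <= _)%N) _.
  by rewrite leq_add2l leq_mul2l geq_minr orbT.
apply: (@sweep_local _ (fun W => local_search W rho C (col W) T0 theta J m)) IH.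
  exact: leq_trans rho_r (leq_addr _ _).
by apply: local_leq col_local; exact: leq_addr.
Qed.

End LocalSweep.

(** * Colour reduction *)

Section PolynomialColouring.
Variable F : finFieldType.
Implicit Types (p q : {poly F}) (x : F) (s : seq nat).

Lemma card_agreement p q : p != q ->
  (#|[set x | p.[x] == q.[x]]| < maxn (size p) (size q))%N.
Proof.
move=> neq_pq; rewrite -(size_polyN q); apply: leq_trans (size_polyD p (- q)).
rewrite cardE; apply: max_poly_roots; rewrite ?enum_uniq ?subr_eq0 //.
by apply/allP => x; rewrite mem_enum inE /root hornerD hornerN subr_eq0.
Qed.

Definition separating p (qs : seq {poly F}) x : bool :=
  all (fun q => (q == p) || (p.[x] != q.[x])) qs.

Lemma separating_exists a p qs :
  (size p <= a)%N -> {in qs, forall q, size q <= a}%N -> (size qs * a < #|F|)%N ->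
  exists x, separating p qs x.
Proof.
move=> size_p size_qs qs_lt; apply/existsP.
apply: contraLR qs_lt => /existsPn no_sep.
pose bad q := if q == p then set0 else [set x : F | p.[x] == q.[x]].
have bad_cover : [set: F] \subset \bigcup_(q <- qs) bad q.
  apply/subsetP => x _; have /allPn[q q_qs] := no_sep x.
  rewrite negb_or negbK => /andP[/negPf neq_qp eq_x].
  by rewrite (big_rem q) //= inE /bad neq_qp inE eq_x.
rewrite -leqNgt -cardsT; apply: leq_trans (subset_leq_card bad_cover) _.
rewrite -sum1_size big_distrl /= big_seq [leqRHS]big_seq.
elim/big_rec2: _ => [|q m A q_qs leAm]; first by rewrite cards0.
rewrite (leq_trans (leq_card_setU _ _)) // mul1n leq_add // /bad.
have [|neq_qp] := eqVneq q p; first by rewrite cards0.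
apply: ltnW; apply: leq_trans (card_agreement _) _; first by rewrite eq_sym.
by rewrite geq_max size_p size_qs.
Qed.

Variable a : nat.

(* Colours below #|F| ^ a are read as polynomials of degree less than a. *)
Definition colour_poly (c : nat) : {poly F} := rVpoly (nth 0 (enum {:'rV[F]_a}) c).

Lemma size_colour_poly c : (size (colour_poly c) <= a)%N.
Proof. exact: size_poly. Qed.

Lemma colour_poly_inj c c' : (c < #|F| ^ a)%N -> (c' < #|F| ^ a)%N ->
  colour_poly c = colour_poly c' -> c = c'.
Proof.
have size_enum : size (enum {:'rV[F]_a}) = (#|F| ^ a)%N.
  by rewrite -cardE card_mx mul1n.
rewrite -size_enum => c_lt c'_lt /(can_inj rVpolyK)/eqP.
by rewrite nth_uniq ?enum_uniq // => /eqP.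
Qed.

Definition linial_recolour c s : nat :=
  let p := colour_poly c in
  let x := odflt 0 [pick x | separating p (map colour_poly s) x] in
  enum_rank (x, p.[x]).

Lemma linial_recolour_lt c s : (linial_recolour c s < #|F| ^ 2)%N.
Proof. by rewrite -mulnn -card_prod ltn_ord. Qed.

Lemma linial_recolour_neq c c' s s' :
  (c < #|F| ^ a)%N -> (c' < #|F| ^ a)%N -> (size s * a < #|F|)%N ->
  c' \in s -> c != c' -> linial_recolour c s != linial_recolour c' s'.
Proof.
move=> c_lt c'_lt s_lt c's; apply: contraNneq => /val_inj/enum_rank_inj [<-].
case: pickP => [x /allP/(_ _ (map_f colour_poly c's)) /orP[]|].
- by move/eqP/colour_poly_inj->.
- by move=> /eqP neq_x /neq_x.
have [|||x x_sep /(_ x)] :=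
    @separating_exists a (colour_poly c) (map colour_poly s).
- exact: size_colour_poly.
- by move=> _ /mapP[d _ ->]; apply: size_colour_poly.
- by rewrite size_map.
- by rewrite x_sep.
Qed.

End PolynomialColouring.

Definition GF2 e : finFieldType :=
  s2val (pPrimePowerField (isT : prime 2) (ltn0Sn e)).

Lemma card_GF2 e : #|GF2 e| = (2 ^ e.+1)%N.
Proof. by rewrite /GF2; case: pPrimePowerField. Qed.

(* Two coordinates in a field GF(2^e) with more than 2^z * a elements. *)
Definition next_bits (z a : nat) : nat := (z + trunc_log 2 a).+1.*2.

Definition colour_bits (z a t : nat) : nat := iter t (next_bits z) a.

Section IteratedColouring.
Variables (R : numDomainType) (I : finType) (ids : I -> nat) (z d a : nat).
Implicit Types (W : I -> I -> R) (t : nat).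

Fixpoint linial_colour t W i : nat :=
  if t is t'.+1 then
    let bits := colour_bits z a t' in
    linial_recolour (GF2 (z + trunc_log 2 bits)) bits (linial_colour t' W i)
      [seq linial_colour t' W j | j <- enum (ball (link W) d i)]
  else ids i.

Lemma linial_colour_local wm t : local wm (t * d) (linial_colour t).
Proof.
elim: t => [|t IH] W W' i W_ge WW' //=.
rewrite (IH _ W') //; last by apply: agree_leq WW'; rewrite mulSn leq_addl.
congr linial_recolour; rewrite -(agree_ball (agree_leq _ WW')) ?mulSn ?leq_addr //.
apply/eq_in_map => j; rewrite mem_enum => ji; apply: IH => //.
by apply: (agree_in_ball ji); rewrite -mulSn.
Qed.

Hypotheses (ids_inj : injective ids) (ids_lt : forall i, (ids i < 2 ^ a)%N).

Lemma linial_colour_lt t W i : (linial_colour t W i < 2 ^ colour_bits z a t)%N.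
Proof.
case: t => [|t] /=; first exact: ids_lt.
apply: leq_trans (linial_recolour_lt _ _ _ _) _.
by rewrite card_GF2 -expnM muln2.
Qed.

Lemma linial_colour_distance t W :
  commutative W -> (forall i, (#|ball (link W) d i| <= 2 ^ z)%N) ->
  distance_colouring (link W) d (linial_colour t W).
Proof.
move=> symW card_le; elim: t => [|t IH] u v vu; first exact: ids_inj.
apply: contra_eq => neq_uv /=; set b := colour_bits z a t; set F := GF2 _.
have lt_F w : (linial_colour t W w < #|F| ^ b)%N.
  apply: leq_trans (linial_colour_lt _ _ _) _; rewrite card_GF2 -expnM.
  by rewrite leq_exp2l // leq_pmull.
apply: linial_recolour_neq => //.
- rewrite size_map -cardE card_GF2 -addnS expnD.
  apply: leq_ltn_trans (_ : 2 ^ z * b < _)%N.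
    by rewrite leq_mul2r card_le orbT.
  by rewrite ltn_pmul2l ?expn_gt0 // trunc_log_ltn.
- by apply: map_f; rewrite mem_enum.
- by apply: contraNneq neq_uv => /(IH _ _ vu)->.
Qed.

End IteratedColouring.

(** * Iterated logarithms *)

Section Logarithms.
Variable R : realType.
Implicit Types x y : R.

Lemma half_le_ln2 : 2^-1 <= ln 2 :> R.
Proof.
rewrite -[leLHS]expRK ler_ln ?posrE ?expR_gt0 // -[leRHS]invrK -[leLHS]invrK.
rewrite lef_pV2 ?posrE ?invr_gt0 ?expR_gt0 // -expRN.
by apply: le_trans (expR_ge1Dx _); lra.
Qed.

Lemma ln2_gt0 : 0 < ln 2 :> R.
Proof. by have := half_le_ln2; lra. Qed.

Lemma log2M x y : 0 < x -> 0 < y -> log2 (x * y) = log2 x + log2 y.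
Proof. by move=> x_gt0 y_gt0; rewrite /log2 lnM ?posrE // mulrDl. Qed.

Lemma log2X n : log2 (2 ^+ n : R) = n%:R.
Proof. by rewrite /log2 lnXn // -[_ *+ n]mulr_natl mulfK // gt_eqF // ln2_gt0. Qed.

Lemma log2_1 : log2 (1 : R) = 0.
Proof. exact: (log2X 0). Qed.

Lemma log2_2 : log2 (2 : R) = 1.
Proof. exact: (log2X 1). Qed.

Lemma ler_log2 x y : 0 < x -> 0 < y -> (log2 x <= log2 y) = (x <= y).
Proof. by move=> x_gt0 y_gt0; rewrite ler_pM2r ?invr_gt0 ?ln2_gt0 // ler_ln. Qed.

Lemma ltr_log2 x y : 0 < x -> 0 < y -> (log2 x < log2 y) = (x < y).
Proof. by move=> x_gt0 y_gt0; rewrite ltr_pM2r ?invr_gt0 ?ln2_gt0 // ltr_ln. Qed.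

Lemma log2_le_subr1 x : 2 <= x -> log2 x <= x - 1.
Proof.
move=> x_ge2; have -> : x = 2 * (1 + (x / 2 - 1)) by field.
rewrite log2M //; last by lra.
have ln_le : ln (1 + (x / 2 - 1)) <= x / 2 - 1 by apply: le_ln1Dx; lra.
suff : log2 (1 + (x / 2 - 1)) <= 2 * (x / 2 - 1) by rewrite log2_2; lra.
rewrite ler_pdivrMr ?ln2_gt0 //; apply: le_trans ln_le _.
by have := half_le_ln2; nra.
Qed.

Lemma trunc_log2_le n x : 1 <= x -> n%:R <= x -> (trunc_log 2 n)%:R <= log2 x.
Proof.
move=> x_ge1 n_x; rewrite -log2X ler_log2 ?exprn_gt0 ?(lt_le_trans ltr01 x_ge1) //.
case: (posnP n) => [->|n_gt0]; first by rewrite trunc_log0 expr0.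
by apply: le_trans n_x; rewrite -natrX ler_nat trunc_logP.
Qed.

Lemma log2_iter_le n i : (forall j, (j <= i)%N -> 1 < iter j (@log2 R) n%:R) ->
  iter i (@log2 R) n%:R <= n%:R - i%:R.
Proof.
elim: i => [|i IH] gt1; first by rewrite subr0.
have {}IH := IH (fun j ji => gt1 j (leqW ji)).
have := gt1 _ (leqnn _); have := gt1 _ (leqnSn _); rewrite iterS.
set x := iter i _ _ in IH * => x_gt1 log_gt1.
have x_ge2 : 2 <= x.
  by apply: ltW; rewrite -ltr_log2 ?log2_2 // (lt_trans ltr01).
by have := log2_le_subr1 x_ge2; rewrite -natr1; lra.
Qed.

Lemma has_logstar n : has (fun i => iter i (@log2 R) n%:R <= 1) (iota 0 n.+1).
Proof.
apply: contraT => /hasPn not_le1.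
have gt1 i : (i <= n)%N -> 1 < iter i (@log2 R) n%:R.
  by move=> i_n; rewrite ltNge not_le1 // mem_iota.
by have := log2_iter_le gt1; rewrite subrr; have := gt1 n (leqnn n); lra.
Qed.

Lemma logstar_leq n : (logstar R n <= n)%N.
Proof. by have := has_logstar n; rewrite has_find size_iota. Qed.

Lemma iter_logstar n : iter (logstar R n) (@log2 R) n%:R <= 1.
Proof.
have := nth_find 0%N (has_logstar n).
by rewrite nth_iota ?add0n // ltnS logstar_leq.
Qed.

Lemma iter_lt_logstar n i : (i < logstar R n)%N -> 1 < iter i (@log2 R) n%:R.
Proof.
move=> i_lt; rewrite ltNge; apply/negbT.
have := before_find 0%N i_lt; rewrite nth_iota ?add0n //.
exact: ltnW (leq_trans i_lt (logstar_leq n)).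
Qed.

Lemma logstar_gt0 n : (1 < n)%N -> (0 < logstar R n)%N.
Proof.
move=> n_gt1; rewrite lt0n; apply: contraTneq (iter_logstar n) => ->.
by rewrite -ltNge ltr1n.
Qed.

Lemma next_bits_le z a (c x : R) : 1 <= c -> 4 + 2 * log2 c <= c -> 1 <= x ->
  a%:R <= c * z.+1%:R * (x + 1) -> (next_bits z a)%:R <= c * z.+1%:R * (log2 x + 1).
Proof.
move=> c_ge1 c_large x_ge1 a_le; set l := log2 x.
have l_ge0 : 0 <= l by rewrite -log2_1 ler_log2 // (lt_le_trans ltr01).
have lc_ge0 : 0 <= log2 c by rewrite -log2_1 ler_log2 // (lt_le_trans ltr01).
have z_ge0 : 0 <= z%:R :> R by [].
have cz_ge1 : 1 <= c * z.+1%:R by rewrite mulr_ege1 // ler1n.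
have log_z : log2 (z.+1%:R : R) <= z%:R.
  by rewrite -[leRHS]log2X ler_log2 ?ltr0n ?exprn_gt0 // -natrX ler_nat ltn_expl.
have log_x : log2 (x + 1) <= l + 1.
  have <- : log2 (x * 2) = l + 1 by rewrite log2M ?log2_2 //; lra.
  by rewrite ler_log2; lra.
have trunc_le : (trunc_log 2 a)%:R <= log2 c + log2 z.+1%:R + log2 (x + 1).
  have <- : log2 (c * z.+1%:R * (x + 1)) = log2 c + log2 z.+1%:R + log2 (x + 1).
    by rewrite !log2M ?ltr0n //; lra.
  by rewrite trunc_log2_le // mulr_ege1 //; lra.
have c_ge4 : 0 <= c - 4 by lra.
rewrite /next_bits -muln2 natrM -[(z + _).+1%:R]natr1 natrD -[z.+1%:R]natr1.
have := mulr_ge0 c_ge4 z_ge0; have := mulr_ge0 c_ge4 l_ge0.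
have := mulr_ge0 (le_trans ler01 c_ge1) (mulr_ge0 z_ge0 l_ge0); lra.
Qed.

Lemma colour_bits_logstar n z a (c : R) :
  (1 < n)%N -> 1 <= c -> 4 + 2 * log2 c <= c ->
  a%:R <= c * (log2 n%:R + 1) ->
  (colour_bits z a (logstar R n).-1)%:R <= 2 * c * z.+1%:R.
Proof.
move=> n_gt1 c_ge1 c_large a_le.
pose x t : R := iter t.+1 (@log2 R) n%:R.
have c_ge0 : 0 <= c by exact: le_trans c_ge1.
have bits_le t : (t < logstar R n)%N ->
    (colour_bits z a t)%:R <= c * z.+1%:R * (x t + 1).
  elim: t => [|t IH] t_lt.
    apply: le_trans a_le _; rewrite -mulrA ler_wpM2l // ler_peMl ?ler1n //.
    have : 0 <= x 0%N by rewrite -log2_1 ler_log2 ?ltr0n ?ler1n ?(ltnW n_gt1).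
    by rewrite /x /=; lra.
  apply: next_bits_le => //; last exact/IH/ltnW.
  exact: ltW (iter_lt_logstar t_lt).
have logstar_pos := logstar_gt0 n_gt1.
apply: le_trans (bits_le _ _) _; first by rewrite prednK.
have : x (logstar R n).-1 <= 1 by rewrite /x prednK // iter_logstar.
have : 0 <= c * z.+1%:R by rewrite mulr_ge0.
by nra.
Qed.

End Logarithms.

(** * Parameters of the algorithm *)

Lemma natr_le_exp2 (R : numDomainType) n : n%:R <= 2 ^+ n :> R.
Proof. by rewrite -natrX ler_nat ltnW // ltn_expl. Qed.

Section Lg.
Variable R : realType.
Implicit Type x : R.

Lemma lg_ge1 x : 1 <= lg x.
Proof. by rewrite /lg le_max lexx. Qed.

Lemma lg_ge0 x : 0 <= lg x.
Proof. exact: le_trans (lg_ge1 x). Qed.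

Lemma truncn_log2_lg x : (Num.truncn (log2 x)).+1%:R <= 2 * lg x.
Proof.
have log_lg : log2 x <= lg x by rewrite /lg le_max lexx orbT.
have [log_ge0|log_lt0] := leP 0 (log2 x).
  have : (Num.truncn (log2 x))%:R <= log2 x by rewrite truncn_le.
  by rewrite -natr1; have := lg_ge1 x; lra.
have -> : Num.truncn (log2 x) = 0%N by apply/truncn0Pn; rewrite -ltNge; lra.
by have := lg_ge1 x; lra.
Qed.

End Lg.

Section Schedule.
Variables (R : realType) (k : nat).
Implicit Types (eps wm : R) (n Delta : nat).

Definition accuracy eps : nat := (Num.truncn eps^-1).+1.
Definition degree_bits Delta : nat := (trunc_log 2 Delta).+1.
Definition degree_bound Delta : nat := 2 ^ degree_bits Delta.
Definition radius eps : nat := (4 * accuracy eps).*2.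
Definition neighbourhood_bits Delta eps : nat :=
  degree_bits Delta * (radius eps).*2.
Definition id_bits n : nat := (k * (trunc_log 2 n).+1).+1.
Definition palette Delta eps : nat :=
  2 ^ (2 ^ (k + 5) * (neighbourhood_bits Delta eps).+1).
Definition sweeps Delta eps : nat :=
  16 * accuracy eps * degree_bound Delta ^ (radius eps).*2.
Definition top_threshold Delta eps : R := (degree_bound Delta ^ radius eps)%:R.
Definition idle_ratio Delta eps : R :=
  (16 * accuracy eps * degree_bound Delta ^ radius eps)%:R^-1.
Definition thresholds n Delta eps : nat := sweeps Delta eps * n * accuracy eps.

(* The thresholds that have an effect when all weights are at least wm. *)
Definition active_thresholds Delta eps wm : nat :=
  sweeps Delta eps + (Num.truncn (log2 wm^-1)).+1.

Definition dependency_radius n Delta eps wm : nat :=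
  (logstar R n).-1 * (radius eps).*2 + (radius eps).*2 +
  sweeps Delta eps *
    ((radius eps).*2 * (active_thresholds Delta eps wm * palette Delta eps)).

(* The view after t.+1 rounds determines the weights of the edges at distance at
   most t. For Delta <= 1 the announced bound leaves no room for the local search,
   but then the set of all edges is a matching. *)
Definition round_count n Delta eps wm : nat :=
  if (Delta <= 1)%N then 0 else (dependency_radius n Delta eps wm).+1.

Lemma degree_bound_gt0 Delta : (0 < degree_bound Delta)%N.
Proof. by rewrite expn_gt0. Qed.

Lemma lt_degree_bound Delta : (Delta < degree_bound Delta)%N.
Proof. exact: trunc_log_ltn. Qed.

Lemma sweeps_gt0 Delta eps : (0 < sweeps Delta eps)%N.
Proof. by rewrite 2!muln_gt0 expn_gt0 degree_bound_gt0. Qed.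

Lemma idle_ratio_gt0 Delta eps : 0 < idle_ratio Delta eps.
Proof. by rewrite invr_gt0 ltr0n 2!muln_gt0 expn_gt0 degree_bound_gt0. Qed.

Lemma accuracy_gt eps : eps^-1 < (accuracy eps)%:R.
Proof. exact: truncnS_gt. Qed.

Lemma eps_accuracy_ge1 eps : 0 < eps -> 1 <= eps * (accuracy eps)%:R.
Proof. by move=> eps_gt0; rewrite -ler_pdivrMl // mulr1 ltW // accuracy_gt. Qed.

Lemma accuracy_le eps : 0 < eps < 1 -> (accuracy eps)%:R <= 2 * eps^-1.
Proof.
case/andP=> eps_gt0 eps_lt1; have inv_ge1 : 1 <= eps^-1 by rewrite invf_ge1 // ltW.
have : (Num.truncn eps^-1)%:R <= eps^-1 by rewrite truncn_le; lra.
by rewrite /accuracy -natr1; lra.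
Qed.

Lemma top_threshold_ratio Delta eps :
  top_threshold Delta eps / idle_ratio Delta eps = (sweeps Delta eps)%:R.
Proof. by rewrite /idle_ratio invrK -natrM mulnC -mulnA -expnD addnn. Qed.

Lemma bottom_threshold_le n Delta eps w : 0 < eps -> (0 < n)%N -> eps / n%:R <= w ->
  threshold (top_threshold Delta eps) (thresholds n Delta eps)
    <= idle_ratio Delta eps * w.
Proof.
move=> eps_gt0 n_gt0 w_ge; rewrite mulrC -ler_pdivrMr ?idle_ratio_gt0 //.
rewrite /threshold mulrAC top_threshold_ratio ler_pdivrMr ?exprn_gt0 //.
have natr_gt0 : 0 < n%:R :> R by rewrite ltr0n.
apply: (@le_trans _ _ (eps / n%:R * (thresholds n Delta eps)%:R)); last first.
  by apply: ler_pM; rewrite ?natr_le_exp2 // divr_ge0 // ltW.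
rewrite /thresholds 2!natrM.
rewrite (_ : eps / n%:R * _ = (sweeps Delta eps)%:R * (eps * (accuracy eps)%:R)).
  by rewrite ler_peMr // eps_accuracy_ge1.
by field; rewrite gt_eqF.
Qed.

Lemma inactive_threshold Delta eps wm j : 0 < wm ->
  (active_thresholds Delta eps wm <= j)%N ->
  threshold (top_threshold Delta eps) j / idle_ratio Delta eps < wm.
Proof.
move=> wm_gt0 j_large; rewrite /threshold mulrAC top_threshold_ratio.
rewrite ltr_pdivrMr ?exprn_gt0 // -ltr_pdivrMl //.
set l := (Num.truncn (log2 wm^-1)).+1.
have wm_lt : wm^-1 < 2 ^+ l.
  by rewrite -ltr_log2 ?invr_gt0 ?exprn_gt0 // log2X truncnS_gt.
apply: (@lt_le_trans _ _ (2 ^+ l * 2 ^+ sweeps Delta eps)); last first.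
  by rewrite -exprD addnC ler_weXn2l // ler1n.
apply: (@lt_le_trans _ _ (2 ^+ l * (sweeps Delta eps)%:R)).
  by rewrite ltr_pM2r // ltr0n sweeps_gt0.
by rewrite ler_wpM2l ?natr_le_exp2 // exprn_ge0.
Qed.

Lemma ltn_exp_id_bits n i : (i <= n ^ k)%N -> (i < 2 ^ id_bits n)%N.
Proof.
move=> i_le; rewrite expnS mul2n -addnn -add1n leq_add ?expn_gt0 //.
apply: leq_trans i_le _; rewrite mulnC expnM.
by case: (posnP k) => [->//|k_gt0]; rewrite leq_exp2r // ltnW // trunc_log_ltn.
Qed.

Lemma palette_ge n Delta eps : (1 < n)%N ->
  (2 ^ colour_bits (neighbourhood_bits Delta eps) (id_bits n) (logstar R n).-1
   <= palette Delta eps)%N.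
Proof.
move=> n_gt1; rewrite leq_exp2l // -(ler_nat R).
have k_lt := ltn_expl k (isT : (1 < 2)%N).
have n_ge2 : 2 <= n%:R :> R by rewrite ler_nat.
pose c : R := 2 ^+ (k + 4).
have c_ge1 : 1 <= c by rewrite /c -natrX ler1n expn_gt0.
have c_large : 4 + 2 * log2 c <= c.
  by rewrite /c log2X -natrX -natrM -natrD ler_nat expnD; lia.
have kc : k%:R + 1 <= c by rewrite /c natr1 -natrX ler_nat expnD; lia.
rewrite natrM natrX addnS exprS -/c; apply: colour_bits_logstar => //.
have log_ge1 : 1 <= log2 (n%:R : R) by rewrite -[leLHS]log2_2 ler_log2 //; lra.
have trunc_le : (trunc_log 2 n)%:R <= log2 n%:R :> R.
  by apply: trunc_log2_le => //; lra.
rewrite /id_bits -natr1 natrM -natr1.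
have := ler_wpM2l (ler0n R k) trunc_le.
have : 0 <= (c - (k%:R + 1)) * (log2 n%:R + 1).
  by rewrite mulr_ge0 ?subr_ge0 //; lra.
lra.
Qed.

Lemma degree_bound_le Delta : (1 < Delta)%N -> (degree_bound Delta <= Delta ^ 2)%N.
Proof.
move=> Delta_gt1; rewrite /degree_bound /degree_bits expnS -mulnn leq_mul //.
by rewrite trunc_logP // ltnW.
Qed.

Lemma double_radius_lt Delta eps :
  ((radius eps).*2 < 2 ^ neighbourhood_bits Delta eps)%N.
Proof. by apply: leq_ltn_trans (ltn_expl _ _) => //; apply: leq_pmull. Qed.

Lemma sweeps_le Delta eps :
  (sweeps Delta eps <= 2 ^ (2 * neighbourhood_bits Delta eps))%N.
Proof.
have radiusE : (radius eps).*2 = (16 * accuracy eps)%N by rewrite /radius; lia.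
rewrite /sweeps /degree_bound -expnM -/(neighbourhood_bits _ _) mul2n -addnn expnD.
by rewrite -radiusE leq_mul2r ltnW ?orbT ?double_radius_lt.
Qed.

Lemma round_factor_le Delta eps : (1 < Delta)%N ->
  (1 + (radius eps).*2 + (radius eps).*2 *
     (sweeps Delta eps * (palette Delta eps * (sweeps Delta eps + 2)))
   <= Delta ^ (64 * (2 ^ (k + 5) + 4) * accuracy eps))%N.
Proof.
move=> Delta_gt1; set c := (2 ^ (k + 5))%N; set d := (radius eps).*2.
have dE : d = (16 * accuracy eps)%N by rewrite /d /radius; lia.
set p := neighbourhood_bits Delta eps.
have p_gt0 : (0 < p)%N by rewrite muln_gt0 -/d dE.
have d_lt : (d < 2 ^ p)%N := double_radius_lt Delta eps.
have sweeps_p : (sweeps Delta eps <= 2 ^ (2 * p))%N := sweeps_le Delta eps.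
have sweeps2_p : (sweeps Delta eps + 2 <= 2 ^ (3 * p))%N.
  have : (2 ^ (3 * p) = 2 ^ (2 * p) * 2 ^ p)%N.
    by rewrite -expnD; congr (2 ^ _)%N; lia.
  have : (0 < 2 ^ (2 * p))%N by rewrite expn_gt0.
  have : (16 <= d)%N by rewrite dE leq_pmulr.
  by move: d_lt sweeps_p; nia.
have palette_p : (palette Delta eps <= 2 ^ (2 * c * p))%N.
  by rewrite leq_exp2l // -/c -/p; nia.
have product_p :
    (d * (sweeps Delta eps * (palette Delta eps * (sweeps Delta eps + 2)))
     <= 2 ^ (p + (2 * p + (2 * c * p + 3 * p))))%N.
  rewrite !(expnD 2 p) (expnD 2 (2 * p)) (expnD 2 (2 * c * p)).
  exact: leq_mul (ltnW d_lt) (leq_mul sweeps_p (leq_mul palette_p sweeps2_p)).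
apply: (@leq_trans (2 ^ (2 * (c + 4) * p))).
  have -> : (2 * (c + 4) * p = (p + (2 * p + (2 * c * p + 3 * p))) + 2 * p)%N.
    by ring.
  set e := (p + _)%N in product_p *; rewrite expnD.
  have : (2 ^ p <= 2 ^ e)%N by rewrite leq_exp2l // leq_addr.
  have : (2 <= 2 ^ (2 * p))%N by rewrite -[leqLHS]expn1 leq_exp2l // muln_gt0.
  by move: d_lt product_p; nia.
have -> : (2 * (c + 4) * p = degree_bits Delta * (32 * (c + 4) * accuracy eps))%N.
  by rewrite /p /neighbourhood_bits -/d dE; ring.
rewrite expnM (_ : 64 * (c + 4) * _ = 2 * (32 * (c + 4) * accuracy eps))%N;
  last by ring.
rewrite (expnM Delta) leq_exp2r; first exact: degree_bound_le.
by rewrite !muln_gt0 addn_gt0 orbT.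
Qed.

Lemma affine_le_scaled (r K C Q l : nat) (L : R) : 1 <= L -> l%:R <= 2 * L ->
  (1 + r + r * (K * (C * (Q + l))))%:R <= (1 + r + r * (K * (C * (Q + 2))))%:R * L.
Proof.
move=> L_ge1 l_le; rewrite !natrD !natrM !natrD.
have : 0 <= r%:R * (K%:R * C%:R) * (2 * L - l%:R) :> R.
  by rewrite !mulr_ge0 // subr_ge0.
have : 0 <= r%:R * (K%:R * C%:R) * Q%:R * (L - 1) :> R.
  by rewrite !mulr_ge0 // subr_ge0.
have : 0 <= (1 + r%:R) * (L - 1) :> R.
  by rewrite mulr_ge0 ?subr_ge0 // addr_ge0.
lra.
Qed.

Lemma colouring_rounds_le n eps : 0 < eps < 1 ->
  ((logstar R n).-1 * (radius eps).*2)%:R <=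
    32 * (eps ^- 2 * lg eps^-1 * (logstar R n)%:R).
Proof.
move=> eps01; have [eps_gt0 eps_lt1] := andP eps01.
have inv_ge1 : 1 <= eps^-1 by rewrite invf_ge1 // ltW.
have pred_le : (logstar R n).-1%:R <= (logstar R n)%:R :> R.
  by rewrite ler_nat leq_pred.
have double_radius_le : (radius eps).*2%:R <= 32 * eps^-1.
  have -> : (radius eps).*2 = (16 * accuracy eps)%N by rewrite /radius; lia.
  by rewrite natrM; have := accuracy_le eps01; lra.
have inv_le : eps^-1 <= eps ^- 2 * lg eps^-1.
  rewrite -exprVn expr2 -mulrA ler_peMr ?mulr_ege1 ?lg_ge1 //.
  exact: le_trans inv_ge1.
rewrite natrM; apply: le_trans (ler_pM _ _ pred_le double_radius_le) _ => //.
by rewrite mulrCA ler_pM2l // mulrC ler_wpM2r.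
Qed.

Lemma search_rounds_le Delta eps wm : 0 < eps < 1 -> (1 < Delta)%N ->
  (1 + (radius eps).*2 + (radius eps).*2 *
     (sweeps Delta eps * (palette Delta eps * active_thresholds Delta eps wm)))%:R <=
  Delta%:R `^ ((128 * (2 ^ (k + 5) + 4))%:R / eps) * lg wm^-1.
Proof.
move=> eps01 Delta_gt1.
apply: le_trans (affine_le_scaled _ _ _ _ (lg_ge1 _) (truncn_log2_lg _)) _.
rewrite ler_wpM2r ?lg_ge0 //; have := round_factor_le eps Delta_gt1.
rewrite -(ler_nat R) => /le_trans; apply.
rewrite natrX -powR_mulrn // ler_powR ?ler1n ?(ltnW Delta_gt1) //.
have -> : (128 * (2 ^ (k + 5) + 4))%:R / eps =
    (64 * (2 ^ (k + 5) + 4))%:R * (2 * eps^-1) :> R by rewrite !natrM; ring.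
by rewrite natrM ler_wpM2l // accuracy_le.
Qed.

Lemma round_count_le n Delta eps wm : 0 < eps < 1 ->
  (round_count n Delta eps wm)%:R <=
  32 * (eps ^- 2 * lg eps^-1 * (logstar R n)%:R) +
  Delta%:R `^ ((128 * (2 ^ (k + 5) + 4))%:R / eps) * lg wm^-1.
Proof.
move=> eps01; rewrite /round_count; case: leqP => [_|Delta_gt1].
  have [/ltW eps_ge0 _] := andP eps01.
  by rewrite addr_ge0 ?mulr_ge0 ?lg_ge0 ?powR_ge0 ?invr_ge0 ?exprn_ge0.
have -> : (dependency_radius n Delta eps wm).+1 =
    ((logstar R n).-1 * (radius eps).*2 + (1 + (radius eps).*2 + (radius eps).*2 *
      (sweeps Delta eps * (palette Delta eps * active_thresholds Delta eps wm))))%N.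
  by rewrite /dependency_radius; ring.
by rewrite natrD lerD ?colouring_rounds_le ?search_rounds_le.
Qed.

End Schedule.

(** * Views *)

Section Views.
Variable R : realType.
Implicit Types (G : wgraph R) (eps : R) (t : nat).

Inductive view := InitialView of local_input R | NextView of view & seq view.

Fixpoint view_at G (N : network G) eps t (v : G) : view :=
  if t is t'.+1 then
    NextView (view_at N eps t' v) [seq view_at N eps t' u | u <- ports N v]
  else InitialView (input_at N eps v).

Fixpoint view_depth (w : view) : nat :=
  if w is NextView w' _ then (view_depth w').+1 else 0.

Fixpoint view_input (w : view) : local_input R :=
  match w with InitialView i => i | NextView w' _ => view_input w' end.

Lemma view_depth_at G (N : network G) eps t v : view_depth (view_at N eps t v) = t.
Proof. by elim: t => //= t ->. Qed.

Lemma view_input_at G (N : network G) eps t v :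
  view_input (view_at N eps t v) = input_at N eps v.
Proof. by elim: t => //= t ->. Qed.

Lemma view_at_inj G (N : network G) G' (N' : network G') eps eps' t t' v v' :
  view_at N eps t v = view_at N' eps' t' v' ->
  t = t' /\ input_at N eps v = input_at N' eps' v'.
Proof.
move=> same; have := congr1 view_depth same; have := congr1 view_input same.
by rewrite !view_depth_at !view_input_at.
Qed.

Lemma view_at_ports_ident G (N : network G) G' (N' : network G') eps eps' t v v' :
  view_at N eps t.+1 v = view_at N' eps' t.+1 v' ->
  [seq ident N u | u <- ports N v] = [seq ident N' u | u <- ports N' v'].
Proof.
move=> [_ /(congr1 (map (fun w => in_id (view_input w))))]; rewrite -!map_comp.
rewrite (eq_map (_ : _ =1 ident N)); last by move=> u; rewrite /= view_input_at.
by rewrite (eq_map (_ : _ =1 ident N')) // => u; rewrite /= view_input_at.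
Qed.

Lemma view_at_port G (N : network G) G' (N' : network G') eps eps' t v v' u :
  view_at N eps t.+1 v = view_at N' eps' t.+1 v' -> u \in ports N v ->
  exists u', view_at N eps t u = view_at N' eps' t u'.
Proof.
move=> [_ same_ports] u_port; have size_ports := congr1 size same_ports.
rewrite !size_map in size_ports.
have u_lt : (index u (ports N v) < size (ports N' v'))%N.
  by rewrite -size_ports index_mem.
exists (nth v' (ports N' v') (index u (ports N v))).
set i := index u _ in u_lt *.
have := congr1 (fun ws => nth (view_at N eps t v) ws i) same_ports.
rewrite (nth_map u) ?index_mem // nth_index // => ->.
exact: nth_map.
Qed.

Section ViewAlgorithm.
Variables (valid : forall G, network G -> Prop).
Variable output : forall G, network G -> R -> G -> pred nat.

Definition view_determines (w : view) (o : pred nat) : Prop :=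
  forall G (N : network G) eps t v,
  valid N -> view_at N eps t v = w -> output N eps v = o.

Definition view_output (w : view) : option (pred nat) :=
  if pselect (exists o, view_determines w o) is left determined
  then Some (sval (cid determined)) else None.

Definition view_algorithm : algorithm R :=
  {| alg_state := view; alg_msg := view; alg_init := InitialView;
     alg_send := fun w _ => w; alg_recv := NextView; alg_out := view_output |}.

Lemma state_at_view G (N : network G) eps t v :
  state_at view_algorithm N eps t v = view_at N eps t v.
Proof.
elim: t v => //= t IH v; congr NextView; first exact: IH.
by apply: eq_map => u; apply: IH.
Qed.

Lemma view_output_sound G (N : network G) eps t v o : valid N ->
  view_output (view_at N eps t v) = Some o -> o = output N eps v.
Proof.
move=> N_valid; rewrite /view_output; case: pselect => // determined [<-].
by case: cid => o' /= /(_ G N eps t v N_valid erefl).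
Qed.

Lemma output_at_sound G (N : network G) eps t v o : valid N ->
  output_at view_algorithm N eps t v = Some o -> o = output N eps v.
Proof.
move=> N_valid; elim: t o => [|t IH] o; first exact: (@view_output_sound _ _ _ 0%N).
rewrite /output_at -/(output_at _ _ _ _ _).
case: output_at IH => [o'|] IH; first exact: IH.
by rewrite state_at_view; apply: view_output_sound.
Qed.

Lemma output_at_view_algorithm G (N : network G) eps t v : valid N ->
  view_determines (view_at N eps t v) (output N eps v) ->
  output_at view_algorithm N eps t v = Some (output N eps v).
Proof.
move=> N_valid determined.
have out_t : view_output (view_at N eps t v) = Some (output N eps v).
  case out: view_output => [o|]; first by rewrite (view_output_sound N_valid out).
  move: out; rewrite /view_output; case: pselect => // -[].
  by exists (output N eps v).
case out: output_at => [o|]; first by rewrite (output_at_sound N_valid out).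
case: t out out_t {determined} => [|t]; first by move=> /= ->.
rewrite /output_at -/(output_at _ _ _ _ _); case: output_at => //.
by rewrite state_at_view => /= ->.
Qed.

End ViewAlgorithm.

End Views.

(** * Weights indexed by identifiers *)

(* Networks with the same view at a vertex may have different vertex types, so the
   local search runs on identifiers. *)
Section IdWeights.
Variables (R : realType) (k : nat).
Implicit Types (G : wgraph R) (n Delta : nat) (eps wm : R).

Local Notation ID n := 'I_(n ^ k).+1.

Definition vertex_of G (N : network G) (i : nat) : option G :=
  [pick u | ident N u == i].

Definition heavy n eps G (u v : G) : bool :=
  ([set u; v] \in edges G) && (eps / n%:R <= wt [set u; v]).

Definition id_weights n eps G (N : network G) (i j : ID n) : R :=
  if (vertex_of N i, vertex_of N j) is (Some u, Some v)
  then if heavy n eps u v then wt [set u; v] else 0 else 0.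

Definition id_index n G (N : network G) (v : G) : ID n := inord (ident N v).

Lemma vertex_of_ident G (N : network G) v : vertex_of N (ident N v) = Some v.
Proof.
rewrite /vertex_of; case: pickP => [u /eqP/ident_inj-> //|/(_ v)].
by rewrite eqxx.
Qed.

Lemma ident_vertex_of G (N : network G) i u :
  vertex_of N i = Some u -> ident N u = i.
Proof. by rewrite /vertex_of; case: pickP => // x /eqP <- [<-]. Qed.

Section OneNetwork.
Variables (n : nat) (eps : R) (G : wgraph R) (N : network G).
Hypothesis ident_le : forall v, (ident N v <= n ^ k)%N.
Implicit Types (u v : G) (i j : ID n).

Local Notation W := (@id_weights n eps G N).
Local Notation idx := (@id_index n G N).

Lemma id_indexK v : idx v = ident N v :> nat.
Proof. by rewrite inordK // ltnS. Qed.

Lemma id_index_inj : injective idx.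
Proof. by move=> u v /(congr1 val); rewrite /= !id_indexK => /ident_inj. Qed.

Lemma vertex_of_index v : vertex_of N (idx v) = Some v.
Proof. by rewrite id_indexK vertex_of_ident. Qed.

Lemma index_vertex_of i v : vertex_of N i = Some v -> i = idx v.
Proof.
by move=> /ident_vertex_of i_v; apply: val_inj; rewrite /= id_indexK i_v.
Qed.

Lemma id_weights_index u v :
  W (idx u) (idx v) = if heavy n eps u v then wt [set u; v] else 0.
Proof. by rewrite /id_weights !vertex_of_index. Qed.

Lemma id_weights_neq0 i j : W i j != 0 ->
  exists u v,
    [/\ i = idx u, j = idx v, heavy n eps u v & W i j = wt [set u; v]].
Proof.
rewrite /id_weights; case Ei: (vertex_of N i) => [u|]; last by rewrite eqxx.
case Ej: (vertex_of N j) => [v|]; last by rewrite eqxx.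
case: ifP => [uv _|]; last by rewrite eqxx.
by exists u, v; split=> //; apply: index_vertex_of.
Qed.

Lemma id_weights_sym : commutative W.
Proof.
move=> i j; rewrite /id_weights.
case: (vertex_of N i) => [u|]; case: (vertex_of N j) => // v.
by rewrite /heavy setUC.
Qed.

Lemma id_weights_diag i : W i i = 0.
Proof.
apply/eqP; apply: contraT => /id_weights_neq0[u [v [-> /id_index_inj-> /andP[]]]].
by move=> /edges_card2; rewrite cards2 eqxx.
Qed.

Lemma id_weights_ge0 i j : 0 <= W i j.
Proof.
have [->//|/id_weights_neq0[u [v [_ _ /andP[uv _] ->]]]] := eqVneq (W i j) 0.
exact: ltW (wt_gt0 uv).
Qed.

Lemma degree_id_weights i : (#|link W i| <= max_degree G)%N.
Proof.
case Ei: (vertex_of N i) => [u|]; last first.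
  rewrite (eq_card0 (_ : _ =i pred0)) // => j.
  by rewrite inE unfold_in /link /id_weights Ei ltxx.
apply: leq_trans (leq_bigmax u); rewrite -(card_imset _ id_index_inj).
apply/subset_leq_card/subsetP => j /lt0r_neq0/id_weights_neq0.
move=> [u' [v [i_u' -> /andP[u'v _] _]]].
have [<-] : Some u' = Some u by rewrite -Ei i_u' vertex_of_index.
by rewrite imset_f // inE.
Qed.

Lemma sum_id_index (F : ID n -> R) :
  (forall i, vertex_of N i = None -> F i = 0) -> \sum_i F i = \sum_v F (idx v).
Proof.
move=> F0; rewrite (bigID (mem [set idx v | v in [set: G]])) /=.
rewrite [X in _ + X]big1 ?addr0.
  rewrite big_imset /=; last by move=> u v _ _; apply: id_index_inj.
  by apply: eq_bigl => v; rewrite inE.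
move=> i; apply: contraNeq.
case Ei: (vertex_of N i) => [u|]; last by rewrite F0 ?eqxx.
by rewrite (index_vertex_of Ei) imset_f ?inE.
Qed.

(* The row of W at a vertex is part of its local input, up to the identifiers of its
   neighbours. *)
Lemma id_weights_ports v j :
  let ids := [seq ident N u | u <- ports N v] in
  let w := nth 0 [seq wt [set v; u] | u <- ports N v] (index (val j) ids) in
  W (idx v) j = if (val j \in ids) && (eps / n%:R <= w) then w else 0.
Proof.
rewrite /id_weights vertex_of_index /=.
case Ej: (vertex_of N j) => [u|]; last first.
  by case: ifP => // /andP[/mapP[u _ j_u] _]; rewrite j_u vertex_of_ident in Ej.
have ids_inj := @ident_inj _ _ N.
rewrite -(ident_vertex_of Ej) (mem_map ids_inj) (index_map ids_inj).
rewrite /heavy ports_nbrs inE; case uv: (_ \in edges G) => //=.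
have u_port : u \in ports N v by rewrite ports_nbrs inE.
by rewrite (nth_map u) ?index_mem // nth_index.
Qed.

End OneNetwork.

Section TwoNetworks.
Variables (n : nat) (eps : R) (G G' : wgraph R) (N : network G) (N' : network G').
Hypothesis ident_le : forall v, (ident N v <= n ^ k)%N.
Hypothesis ident_le' : forall v, (ident N' v <= n ^ k)%N.

Lemma id_weights_view t v v' : view_at N eps t.+1 v = view_at N' eps t.+1 v' ->
  id_weights eps N (id_index n N v) =1 id_weights eps N' (id_index n N v).
Proof.
move=> same j; have [_ same_input] := view_at_inj same.
have same_id : ident N v = ident N' v' := congr1 (@in_id _) same_input.
rewrite {2}/id_index same_id -/(id_index n N' v') !id_weights_ports //.
by rewrite (view_at_ports_ident same) (congr1 (@in_wts _) same_input : map _ _ = _).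
Qed.

Lemma view_agree t v v' : view_at N eps t.+1 v = view_at N' eps t.+1 v' ->
  agree (@id_weights n eps G N) (@id_weights n eps G' N') t (id_index n N v).
Proof.
elim: t v v' => [|t IH] v v' same i.
  by rewrite inE => /eqP->; apply: id_weights_view same.
case/ballSP=> [->|[j vj ij]]; first exact: id_weights_view same.
have [_ [u [/(id_index_inj ident_le) <- j_u /andP[vu _] _]]] :=
  id_weights_neq0 ident_le (lt0r_neq0 vj).
have u_port : u \in ports N v by rewrite ports_nbrs inE.
have [u' same_u] := view_at_port same u_port.
by apply: (IH u u' same_u); rewrite -j_u.
Qed.

End TwoNetworks.

Definition id_colour n Delta eps (W : ID n -> ID n -> R) : ID n -> nat :=
  linial_colour val (neighbourhood_bits Delta eps) (radius eps).*2 (id_bits k n)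
    (logstar R n).-1 W.

Definition id_matching n Delta eps (W : ID n -> ID n -> R) : ID n -> ID n :=
  local_search W (radius eps) (palette k Delta eps) (id_colour Delta eps W)
    (top_threshold Delta eps) (idle_ratio Delta eps) (thresholds n Delta eps)
    (sweeps Delta eps).

Definition port_output n Delta eps G (N : network G) (v : G) : pred nat := fun p =>
  (Delta <= 1)%N ||
  (nat_of_ord (id_matching Delta eps (id_weights eps N) (id_index n N v))
     == nth 0%N [seq ident N u | u <- ports N v] p).

Definition bounded_ids G (N : network G) : Prop :=
  forall v, (ident N v <= #|G| ^ k)%N.

Definition mwm_algorithm : algorithm R :=
  view_algorithm bounded_ids (fun G N eps => port_output #|G| (max_degree G) eps N).

Lemma id_matching_local n Delta eps wm : 0 < wm ->
  local wm (dependency_radius k n Delta eps wm) (@id_matching n Delta eps).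
Proof.
move=> wm_gt0; apply: local_search_local.
- by rewrite expn_gt0.
- by move=> j; apply: inactive_threshold.
- exact: leq_addl.
- by apply: local_leq (leq_addr _ _) _; apply: linial_colour_local.
Qed.

Lemma view_determines_port_output G (N : network G) eps wm v :
  0 < wm -> bounded_ids N ->
  (forall i j, 0 < @id_weights #|G| eps G N i j -> wm <= id_weights eps N i j) ->
  view_determines bounded_ids (fun G N eps => port_output #|G| (max_degree G) eps N)
    (view_at N eps (round_count k #|G| (max_degree G) eps wm) v)
    (port_output #|G| (max_degree G) eps N v).
Proof.
move=> wm_gt0 N_ids W_ge G' N' eps' t v' N'_ids same.
have [t_eq same_input] := view_at_inj same; subst t.
have same_eps : eps' = eps := congr1 (@in_eps _) same_input; subst eps'.
have same_n : #|G'| = #|G| := congr1 (@in_n _) same_input.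
have same_Delta : max_degree G' = max_degree G := congr1 (@in_maxdeg _) same_input.
have same_id : ident N' v' = ident N v := congr1 (@in_id _) same_input.
rewrite /bounded_ids same_n in N'_ids; rewrite same_n same_Delta.
apply/funext => p; rewrite /port_output.
move: same; rewrite /round_count; case: leqP => //= _ same.
rewrite (view_at_ports_ident same) /id_index same_id -/(id_index _ N v).
by rewrite (id_matching_local wm_gt0 W_ge (view_agree N_ids N'_ids (esym same))).
Qed.

End IdWeights.

(** * Correctness *)

Section Edges.
Variables (R : realType) (G : wgraph R).
Implicit Types (M : {set {set G}}) (e : {set G}) (u v x y : G).

Lemma edge_pair e x : e \in edges G -> x \in e -> exists y, e = [set x; y].
Proof.
move=> /edges_card2/eqP/cards2P[a [b [_ ->]]].
by rewrite !inE => /orP[]/eqP->; [exists b|exists a; rewrite setUC].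
Qed.

Lemma edge_neq u v : [set u; v] \in edges G -> u != v.
Proof. by move/edges_card2; rewrite cards2; case: eqP. Qed.

Lemma matchingP M : reflect (M \subset edges G /\
    forall x y y', [set x; y] \in M -> [set x; y'] \in M -> y = y') (matching M).
Proof.
apply: (iffP andP) => -[sM M_uniq]; split=> //.
  move=> x y y' xy xy'; have : [set x; y] = [set x; y'].
    apply: contraTeq (set21 x y) => neq.
    by rewrite (disjointFl (trivIsetP M_uniq _ _ xy xy' neq)) // set21.
  move/setP/(_ y); rewrite !inE eqxx orbT => /esym/orP[|/eqP //].
  by have /edge_neq := subsetP sM _ xy; rewrite eq_sym => /negPf->.
apply/trivIsetP => e e' eM e'M; apply: contraR => /pred0Pn[x /andP[/= xe xe']].
have [y eE] := edge_pair (subsetP sM _ eM) xe.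
have [y' e'E] := edge_pair (subsetP sM _ e'M) xe'.
by subst e e'; rewrite (M_uniq _ _ _ eM e'M).
Qed.

Definition weight_at M v : R := \sum_(e in M | v \in e) wt e.

Lemma weight_double M : M \subset edges G -> 2 * weight M = \sum_v weight_at M v.
Proof.
move=> sM; rewrite (exchange_big_dep (mem M)) => [|v e _ /andP[]//] /=.
rewrite /weight mulr_sumr; apply: eq_bigr => e eM.
transitivity (\sum_(v in e) wt e); last by apply: eq_bigl => v; rewrite eM.
by rewrite sumr_const (edges_card2 (subsetP sM _ eM)) mulr_natl.
Qed.

Lemma weight_at_ge0 M v : M \subset edges G -> 0 <= weight_at M v.
Proof. by move=> sM; apply: sumr_ge0 => e /andP[/(subsetP sM)/wt_gt0/ltW]. Qed.

Lemma weight_at_ge M v u : M \subset edges G -> [set v; u] \in M ->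
  wt [set v; u] <= weight_at M v.
Proof.
move=> sM vu; rewrite /weight_at (bigD1 [set v; u]) /=; last by rewrite vu set21.
by rewrite lerDl; apply: sumr_ge0 => e /andP[/andP[/(subsetP sM)/wt_gt0/ltW]].
Qed.

Lemma weight_at_matching M v u : matching M -> [set v; u] \in M ->
  weight_at M v = wt [set v; u].
Proof.
move=> /matchingP[sM M_uniq] vu; apply: big_pred1 => e.
apply/andP/eqP => [[eM ve]|->]; last by rewrite vu set21.
by have [y eE] := edge_pair (subsetP sM _ eM) ve; rewrite eE (M_uniq v y u) -?eE.
Qed.

Lemma weight_at_unmatched M v : M \subset edges G ->
  (forall u, [set v; u] \notin M) -> weight_at M v = 0.
Proof.
move=> sM unmatched; apply: big1 => e /andP[eM ve].
have [y eE] := edge_pair (subsetP sM _ eM) ve.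
by have := unmatched y; rewrite -eE eM.
Qed.

Lemma weight_sub M M' : M \subset M' -> M' \subset edges G -> weight M <= weight M'.
Proof.
move=> sMM' sM'; rewrite /weight [leRHS](big_setID M) /= (setIidPr sMM') lerDl.
by apply: sumr_ge0 => e; rewrite inE => /andP[_ /(subsetP sM')/wt_gt0/ltW].
Qed.

Lemma wmin_gt0 eps : 0 < wmin G eps.
Proof.
rewrite /wmin; elim/big_ind: _ => // [x y x_gt0 y_gt0|e /andP[eG _]].
  by rewrite lt_min x_gt0.
exact: wt_gt0.
Qed.

Lemma wmin_le eps e : e \in edges G -> eps / #|G|%:R <= wt e -> wmin G eps <= wt e.
Proof. by move=> eG e_heavy; rewrite /wmin (bigD1 e) /= ?eG // ge_min lexx. Qed.

Lemma edges_matching : (max_degree G <= 1)%N -> matching (edges G).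
Proof.
move=> Delta_le1; apply/matchingP; split=> // x y y' xy xy'.
have degree_le : (#|nbrs x| <= max_degree G)%N by apply: leq_bigmax.
have /card_le1_eqP := leq_trans degree_le Delta_le1.
by apply; rewrite inE.
Qed.

Lemma edges_approx_mwm eps :
  0 <= eps -> (max_degree G <= 1)%N -> approx_mwm eps (edges G).
Proof.
move=> eps_ge0 Delta_le1; split=> [|M [/andP[sM _] _]]; first exact: edges_matching.
apply: le_trans (weight_sub sM (subxx _)); rewrite ler_piMl ?gerBl //.
by apply: sumr_ge0 => e /(subsetP sM)/wt_gt0/ltW.
Qed.

Hypothesis G_normalized : normalized G.

Lemma normalized_wt_le1 e : e \in edges G -> wt e <= 1.
Proof. by move=> eG; rewrite -G_normalized (bigD1 e) //= le_max lexx. Qed.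

Lemma normalized_wt1 : exists2 e, e \in edges G & wt e = 1.
Proof.
have [/exists_inP[e eG /eqP e1]|/exists_inPn neq1] :=
    boolP [exists e in edges G, wt e == 1].
  by exists e.
suff : \big[Num.max/0]_(e in edges G) wt e < 1 by rewrite G_normalized ltxx.
elim/big_ind: _ => // [x y x_lt1 y_lt1|e eG]; first by rewrite gt_max x_lt1.
by rewrite lt_neqAle normalized_wt_le1 // neq1.
Qed.

Lemma normalized_card_gt1 : (1 < #|G|)%N.
Proof. by have [e /edges_card2 <- _] := normalized_wt1; apply: max_card. Qed.

Lemma max_weight_ge1 M : max_weight_matching M -> 1 <= weight M.
Proof.
have [e eG e1] := normalized_wt1; move=> [_ /(_ [set e])].
rewrite /weight big_set1 e1; apply; rewrite /matching sub1set eG /=.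
by apply/trivIsetP => a b; rewrite !inE => /eqP-> /eqP->; rewrite eqxx.
Qed.

End Edges.

Section PairingsAndMatchings.
Variables (R : realType) (k n : nat) (eps : R) (G : wgraph R) (N : network G).
Hypothesis ident_le : forall v, (ident N v <= n ^ k)%N.

Local Notation ID := 'I_(n ^ k).+1.
Local Notation W := (@id_weights R k n eps G N).
Local Notation idx := (@id_index R k n G N).

Lemma pairing_weight_index (mu : ID -> ID) :
  pairing_weight W mu = \sum_v W (idx v) (mu (idx v)).
Proof. by apply: (sum_id_index ident_le) => i Ei; rewrite /id_weights Ei. Qed.

Definition pairing_edges (mu : ID -> ID) : {set {set G}} :=
  [set e in edges G |
     [exists v, exists u, (e == [set v; u]) && (mu (idx v) == idx u)]].

Section EdgesOfPairing.
Variable mu : ID -> ID.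
Hypothesis mu_pairing : pairing W mu.

Lemma mem_pairing_edges v u : ([set v; u] \in pairing_edges mu) =
  ([set v; u] \in edges G) && (mu (idx v) == idx u).
Proof.
have [muK _] := pairingP _ _ mu_pairing.
rewrite inE; case vu: (_ \in edges G) => //=.
apply/existsP/idP => [[v' /existsP[u' /andP[/eqP E /eqP mu_v']]]|mu_v]; last first.
  by exists v; apply/existsP; exists u; rewrite eqxx.
have neq_vu := edge_neq vu.
have : v \in [set v'; u'] by rewrite -E set21.
have : u \in [set v'; u'] by rewrite -E set22.
rewrite !inE => /orP[]/eqP eu /orP[]/eqP ev; subst;
  rewrite ?mu_v' ?eqxx // in neq_vu *.
by rewrite -mu_v' muK.
Qed.

Lemma pairing_edges_matching : matching (pairing_edges mu).
Proof.
apply/matchingP; split; first by apply/subsetP => e; rewrite inE => /andP[].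
move=> x y y'; rewrite !mem_pairing_edges => /andP[_ /eqP->] /andP[_ /eqP].
exact: id_index_inj.
Qed.

Lemma pairing_edges_weight : pairing_weight W mu <= 2 * weight (pairing_edges mu).
Proof.
have /andP[sM _] := pairing_edges_matching.
rewrite weight_double // pairing_weight_index; apply: ler_sum => v _.
have [->|] := eqVneq (W (idx v) (mu (idx v))) 0; first exact: weight_at_ge0.
move=> /(id_weights_neq0 ident_le).
move=> [v' [u [/(id_index_inj ident_le) <- mu_v /andP[vu _] ->]]].
by apply: weight_at_ge => //; rewrite mem_pairing_edges vu mu_v eqxx.
Qed.

End EdgesOfPairing.

Section PairingOfMatching.
Variable M : {set {set G}}.
Hypothesis M_matching : matching M.

Definition heavy_partner (v u : G) : bool := ([set v; u] \in M) && heavy n eps v u.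

Definition matching_pairing (i : ID) : ID :=
  if vertex_of N i is Some v then
    if [pick u | heavy_partner v u] is Some u then idx u else i
  else i.

Lemma heavy_partner_sym u v : heavy_partner u v = heavy_partner v u.
Proof. by rewrite /heavy_partner /heavy setUC. Qed.

Lemma matching_pairing_index v u :
  heavy_partner v u -> matching_pairing (idx v) = idx u.
Proof.
have /matchingP[_ M_uniq] := M_matching.
move=> vu; rewrite /matching_pairing vertex_of_index //.
case: pickP => [u' vu'|/(_ u)].
  by case/andP: vu vu' => vu _ /andP[vu' _]; rewrite (M_uniq v u' u).
by rewrite vu.
Qed.

Lemma matching_pairing_cases i : matching_pairing i = i \/
  exists v u, [/\ i = idx v, matching_pairing i = idx u & heavy_partner v u].
Proof.
rewrite /matching_pairing; case Ei: (vertex_of N i) => [v|]; last by left.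
case: pickP => [u vu|_]; last by left.
by right; exists v, u; split=> //; apply: index_vertex_of.
Qed.

Lemma matching_pairing_is_pairing : pairing W matching_pairing.
Proof.
apply/pairingP; split=> i;
  have [fix_i|[v [u [-> -> vu]]]] := matching_pairing_cases i.
- by rewrite !fix_i.
- by apply: matching_pairing_index; rewrite heavy_partner_sym.
- by left.
- right; case/andP: vu => _ vu; rewrite id_weights_index // vu.
  by case/andP: vu => /wt_gt0.
Qed.

Lemma matching_pairing_weight : 0 <= eps ->
  2 * weight M - eps / n%:R *+ #|G| <= pairing_weight W matching_pairing.
Proof.
move=> eps_ge0; have /andP[sM _] := M_matching.
rewrite -sumr_const weight_double // pairing_weight_index -sumrB.
apply: ler_sum => v _; rewrite lerBlDr.
have light_ge0 : 0 <= eps / n%:R by rewrite divr_ge0.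
have [/existsP[u vu]|/existsPn unmatched] :=
    boolP [exists u, [set v; u] \in M]; last first.
  by rewrite weight_at_unmatched // addr_ge0 ?id_weights_ge0.
rewrite (weight_at_matching M_matching vu).
have [vu_heavy|vu_light] := leP (eps / n%:R) (wt [set v; u]).
  have heavy_vu : heavy n eps v u by rewrite /heavy (subsetP sM).
  rewrite (@matching_pairing_index v u) ?/heavy_partner ?vu //.
  by rewrite id_weights_index // heavy_vu lerDl.
by rewrite (le_trans (ltW vu_light)) // lerDr id_weights_ge0.
Qed.

End PairingOfMatching.

End PairingsAndMatchings.

Section Correctness.
Variables (R : realType) (k : nat) (G : wgraph R) (N : network G) (eps : R).
Hypotheses (G_normalized : normalized G) (eps01 : 0 < eps < 1).
Hypothesis N_ids : bounded_ids k N.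

Local Notation n := #|G|.
Local Notation Delta := (max_degree G).
Local Notation W := (@id_weights R k n eps G N).
Local Notation mu := (id_matching Delta eps W).

Let eps_gt0 : 0 < eps. Proof. by case/andP: eps01. Qed.
Let n_gt1 : (1 < n)%N. Proof. exact: normalized_card_gt1. Qed.

Lemma id_weights_le1 i j : W i j <= 1.
Proof.
have [->//|] := eqVneq (W i j) 0.
move=> /(id_weights_neq0 N_ids)[u [v [_ _ /andP[uv _] ->]]].
exact: normalized_wt_le1.
Qed.

Lemma id_weights_wmin i j : 0 < W i j -> wmin G eps <= W i j.
Proof.
move=> /lt0r_neq0/(id_weights_neq0 N_ids)[u [v [_ _ /andP[uv uv_heavy] ->]]].
exact: wmin_le.
Qed.

Lemma degree_id_weights_lt i : (#|link W i| < degree_bound Delta)%N.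
Proof.
exact: leq_ltn_trans (degree_id_weights eps N_ids i) (lt_degree_bound _).
Qed.

Lemma id_colour_distance :
  distance_colouring (link W) (radius eps).*2 (id_colour Delta eps W).
Proof.
apply: linial_colour_distance.
- exact: val_inj.
- by move=> i; apply: ltn_exp_id_bits; rewrite -ltnS ltn_ord.
- exact: id_weights_sym.
- move=> i; rewrite /neighbourhood_bits expnM.
  exact/card_ball/degree_id_weights_lt.
Qed.

Lemma id_colour_lt i : (id_colour Delta eps W i < palette k Delta eps)%N.
Proof.
apply: leq_trans (palette_ge _ _ _ n_gt1); apply: linial_colour_lt => j.
by apply: ltn_exp_id_bits; rewrite -ltnS ltn_ord.
Qed.

Lemma id_matching_pairing : pairing W mu.
Proof.
by apply: local_search_pairing id_colour_distance _; exact: id_weights_sym.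
Qed.

Lemma id_matching_approx nu : pairing W nu ->
  (1 - (2 * (accuracy eps)%:R)^-1) * pairing_weight W nu <= pairing_weight W mu.
Proof.
apply: local_search_approx (leqnn _).
- exact: id_weights_sym.
- exact: id_weights_diag.
- exact: id_weights_ge0.
- exact: id_weights_le1.
- exact: degree_id_weights_lt.
- exact: id_colour_distance.
- exact: id_colour_lt.
- exact: idle_ratio_gt0.
- exact: lexx.
- move=> i j /lt0r_neq0/(id_weights_neq0 N_ids)[u [v [_ _ /andP[_ uv_heavy] ->]]].
  by apply: bottom_threshold_le uv_heavy => //; apply: ltnW.
- by [].
- exact: degree_bound_gt0.
- exact: leqnn.
- by rewrite mulVf // -invr_eq0 gt_eqF // idle_ratio_gt0.
Qed.

Definition mwm_edges : {set {set G}} :=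
  if (Delta <= 1)%N then edges G else pairing_edges N mu.

Lemma pairing_edges_approx : approx_mwm eps (pairing_edges N mu).
Proof.
have mu_matching := pairing_edges_matching N_ids id_matching_pairing.
split=> // M M_max; have M_ge1 := max_weight_ge1 G_normalized M_max.
have [M_matching _] := M_max.
have opt_ge := matching_pairing_weight N_ids M_matching (ltW eps_gt0).
rewrite -[X in _ - X]mulr_natr divfK ?pnatr_eq0 -?lt0n ?(ltnW n_gt1) // in opt_ge.
have mu_ge := id_matching_approx (matching_pairing_is_pairing eps N_ids M_matching).
have mu_le := pairing_edges_weight N_ids id_matching_pairing.
have inv_le : (2 * (accuracy eps)%:R)^-1 <= eps / 2.
  rewrite invfM mulrC ler_wpM2r ?invr_ge0 // ltW //.
  by rewrite invf_plt ?posrE ?ltr0n // accuracy_gt.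
have scaled : (1 - eps / 2) * (2 * weight M - eps)
    <= (1 - (2 * (accuracy eps)%:R)^-1)
       * pairing_weight W (matching_pairing eps N M).
  have [_ eps_lt1] := andP eps01; apply: ler_pM => //; lra.
have : 0 <= eps * (weight M - 1) by rewrite mulr_ge0 ?subr_ge0 // ltW.
by have := sqr_ge0 eps; rewrite expr2; lra.
Qed.

Lemma mwm_edges_approx : approx_mwm eps mwm_edges.
Proof.
rewrite /mwm_edges; case: leqP => [Delta_le1|_]; last exact: pairing_edges_approx.
exact: edges_approx_mwm (ltW eps_gt0) Delta_le1.
Qed.

Lemma mwm_edges_computed :
  computes_in (mwm_algorithm R k) N eps
    (round_count k n Delta eps (wmin G eps)) mwm_edges.
Proof.
move=> v; eexists.
  apply: output_at_view_algorithm => //; apply: view_determines_port_output => //.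
    exact: wmin_gt0.
  exact: id_weights_wmin.
move=> u; rewrite inE /port_output /mwm_edges => vu.
case: leqP => _ /=; first by rewrite vu.
have u_port : u \in ports N v by rewrite ports_nbrs inE.
rewrite (mem_pairing_edges id_matching_pairing) vu.
by rewrite (nth_map u) ?index_mem // nth_index //= -(id_indexK N_ids u) val_eqE.
Qed.

End Correctness.

Theorem theorem27 (R : realType) (k : nat) :
  exists (C1 C2 : R) (A : algorithm R) (r : nat -> nat -> R -> R -> nat),
  forall (eps : R), 0 < eps < 1 ->
  forall (G : wgraph R), normalized G ->
  let n := #|G| in
  let Delta := max_degree G in
  let rounds := r n Delta eps (wmin G eps) in
  rounds%:R <= C1 * (eps ^- 2 * lg eps^-1 * (logstar R n)%:R)
               + Delta%:R `^ (C2 / eps) * lg (wmin G eps)^-1 /\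
  forall (N : network G), (forall v : G, (ident N v <= n ^ k)%N) ->
  exists2 M : {set {set G}},
    computes_in A N eps rounds M & approx_mwm eps M.
Proof.
exists 32, (128 * (2 ^ (k + 5) + 4))%:R, (mwm_algorithm R k), (@round_count R k).
move=> eps eps01 G G_normalized n Delta rounds; split; first exact: round_count_le.
move=> N N_ids; exists (mwm_edges k N eps).
  exact: mwm_edges_computed.
exact: mwm_edges_approx.
Qed.
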